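(* Let $1<p<\infty$ with $p\neq2$. There exist trivial isomorphic extensions $\phi_1,\phi_2$ of $K(l^p)$ by $C[0,1]$ that are not equivalent. Moreover, $[\phi_1]\neq[\phi_2]+[\phi_3]$ for every isomorphic extension $\phi_3$ of $K(l^p)$ by $C[0,1]$.
   Context: $\pi:B(l^p)\to B(l^p)/K(l^p)$ is the quotient map. A homomorphism of Banach algebras is an isomorphism (into) if it is bounded above and below by constant multiples of the norm. An isomorphic extension of $K(l^p)$ by $C[0,1]$ is a unital isomorphism (into) $\phi:C[0,1]\to B(l^p)/K(l^p)$; it is trivial if $\phi=\pi\circ\rho$ for a unital isomorphism (into) $\rho:C[0,1]\to B(l^p)$. $\phi_1,\phi_2$ are equivalent if there is an invertible $S\in B(l^p)$ with $\phi_2(a)=\pi(S)\phi_1(a)\pi(S)^{-1}$ for all $a$; $[\phi]$ is the equivalence class, and $[\phi_1]+[\phi_2]$ is the class of $a\mapsto\pi(S_0(T_1\oplus T_2)S_0^{-1})$ where $\pi(T_i)=\phi_i(a)$ and $S_0:l^p\oplus l^p\to l^p$ is any invertible operator. *)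

(* Defs.v *)
From Stdlib Require Import Reals Lra.
Open Scope R_scope.

Definition C := (R * R)%type.
Definition C0 : C := (0, 0).
Definition C1 : C := (1, 0).
Definition Cadd (z w : C) : C := (fst z + fst w, snd z + snd w).
Definition Copp (z : C) : C := (- fst z, - snd z).
Definition Cmul (z w : C) : C :=
  (fst z * fst w - snd z * snd w, fst z * snd w + snd z * fst w).
Definition Cabs (z : C) : R := sqrt (fst z ^ 2 + snd z ^ 2).

Definition rpow (x p : R) : R := if Rlt_dec 0 x then Rpower x p else 0.

Definition seqC := nat -> C.
Definition vadd (x y : seqC) : seqC := fun n => Cadd (x n) (y n).
Definition vscal (a : C) (x : seqC) : seqC := fun n => Cmul a (x n).
Definition vsub (x y : seqC) : seqC := fun n => Cadd (x n) (Copp (y n)).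

Definition psum (p : R) (x : seqC) (N : nat) : R :=
  sum_f_R0 (fun n => rpow (Cabs (x n)) p) N.
Definition in_lp (p : R) (x : seqC) : Prop := exists l, Un_cv (psum p x) l.
Definition lp_norm_is (p : R) (x : seqC) (r : R) : Prop :=
  0 <= r /\ Un_cv (psum p x) (rpow r p).

Definition op := seqC -> seqC.
Definition opadd (T U : op) : op := fun x => vadd (T x) (U x).
Definition opsub (T U : op) : op := fun x => vsub (T x) (U x).
Definition opscal (a : C) (T : op) : op := fun x => vscal a (T x).
Definition opcomp (T U : op) : op := fun x => T (U x).
Definition opid : op := fun x => x.
Definition op_eq (p : R) (T U : op) : Prop := forall x, in_lp p x -> T x = U x.

Definition opnorm_le (p : R) (T : op) (c : R) : Prop :=
  forall x r s, lp_norm_is p x r -> lp_norm_is p (T x) s -> s <= c * r.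
Definition bounded_op (p : R) (T : op) : Prop :=
  (forall x, in_lp p x -> in_lp p (T x)) /\
  (forall (a b : C) x y, in_lp p x -> in_lp p y ->
     T (vadd (vscal a x) (vscal b y)) = vadd (vscal a (T x)) (vscal b (T y))) /\
  (exists M, opnorm_le p T M).
Definition compact_op (p : R) (T : op) : Prop :=
  bounded_op p T /\
  forall (xs : nat -> seqC) (M : R),
    (forall k, in_lp p (xs k) /\ forall r, lp_norm_is p (xs k) r -> r <= M) ->
    exists (g : nat -> nat) (y : seqC),
      (forall k, (g k < g (S k))%nat) /\ in_lp p y /\
      forall eps, eps > 0 -> exists K, forall k, (K <= k)%nat ->
        forall r, lp_norm_is p (vsub (T (xs (g k))) y) r -> r < eps.
Definition invertible_op (p : R) (S Sinv : op) : Prop :=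
  bounded_op p S /\ bounded_op p Sinv /\
  op_eq p (opcomp S Sinv) opid /\ op_eq p (opcomp Sinv S) opid.

(* Calkin quotient norm: ||pi(T)|| = inf_{K compact} ||T + K|| *)
Definition calkin_norm_le (p : R) (T : op) (c : R) : Prop :=
  forall eps, eps > 0 -> exists K, compact_op p K /\ opnorm_le p (opadd T K) (c + eps).
Definition calkin_norm_ge (p : R) (T : op) (c : R) : Prop :=
  forall K d, compact_op p K -> opnorm_le p (opadd T K) d -> c <= d.
Definition opnorm_ge (p : R) (T : op) (c : R) : Prop :=
  forall d, opnorm_le p T d -> c <= d.

Definition cfun := R -> C.
Definition in_C01 (f : cfun) : Prop :=
  forall t, 0 <= t <= 1 -> forall eps, eps > 0 -> exists delta, delta > 0 /\
    forall s, 0 <= s <= 1 -> Rabs (s - t) < delta -> Cabs (Cadd (f s) (Copp (f t))) < eps.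
Definition supnorm_is (f : cfun) (r : R) : Prop :=
  is_lub (fun y => exists t, 0 <= t <= 1 /\ y = Cabs (f t)) r.
Definition fadd (f g : cfun) : cfun := fun t => Cadd (f t) (g t).
Definition fscal (a : C) (f : cfun) : cfun := fun t => Cmul a (f t).
Definition fmul (f g : cfun) : cfun := fun t => Cmul (f t) (g t).
Definition fone : cfun := fun _ => C1.

(* ---------- extensions ----------
   A map phi : C[0,1] -> B(l^p)/K(l^p) is represented by a lift Phi : C[0,1] -> B(l^p)
   with phi(f) = pi(Phi f).  *)
Definition iso_ext (p : R) (Phi : cfun -> op) : Prop :=
  (forall f, in_C01 f -> bounded_op p (Phi f)) /\
  (forall a b f g, in_C01 f -> in_C01 g ->
     compact_op p (opsub (Phi (fadd (fscal a f) (fscal b g)))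
                         (opadd (opscal a (Phi f)) (opscal b (Phi g))))) /\
  (forall f g, in_C01 f -> in_C01 g ->
     compact_op p (opsub (Phi (fmul f g)) (opcomp (Phi f) (Phi g)))) /\
  compact_op p (opsub (Phi fone) opid) /\
  exists c Cst, 0 < c /\ 0 < Cst /\
    forall f r, in_C01 f -> supnorm_is f r ->
      calkin_norm_ge p (Phi f) (c * r) /\ calkin_norm_le p (Phi f) (Cst * r).

Definition trivial_ext (p : R) (Phi : cfun -> op) : Prop :=
  iso_ext p Phi /\
  exists rho : cfun -> op,
    (forall f, in_C01 f -> bounded_op p (rho f)) /\
    (forall a b f g, in_C01 f -> in_C01 g ->
       op_eq p (rho (fadd (fscal a f) (fscal b g)))
               (opadd (opscal a (rho f)) (opscal b (rho g)))) /\
    (forall f g, in_C01 f -> in_C01 g ->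
       op_eq p (rho (fmul f g)) (opcomp (rho f) (rho g))) /\
    op_eq p (rho fone) opid /\
    (exists c Cst, 0 < c /\ 0 < Cst /\
      forall f r, in_C01 f -> supnorm_is f r ->
        opnorm_ge p (rho f) (c * r) /\ opnorm_le p (rho f) (Cst * r)) /\
    (forall f, in_C01 f -> compact_op p (opsub (Phi f) (rho f))).

Definition equiv_ext (p : R) (Phi1 Phi2 : cfun -> op) : Prop :=
  exists S Sinv, invertible_op p S Sinv /\
    forall f, in_C01 f ->
      compact_op p (opsub (opcomp S (opcomp (Phi1 f) Sinv)) (Phi2 f)).

(* Sum of classes: S0 (T1 (+) T2) S0^{-1}, with S0 : l^p (+)_p l^p -> l^p the
   (isometric, invertible) interleaving S0(x,y) = (x0,y0,x1,y1,...). *)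
Definition evens (z : seqC) : seqC := fun n => z (2 * n)%nat.
Definition odds (z : seqC) : seqC := fun n => z (S (2 * n)).
Definition interleave (x y : seqC) : seqC :=
  fun n => if Nat.even n then x (Nat.div2 n) else y (Nat.div2 n).
Definition dsum (T1 T2 : op) : op :=
  fun z => interleave (T1 (evens z)) (T2 (odds z)).
Definition sum_ext (Phi2 Phi3 : cfun -> op) : cfun -> op :=
  fun f => dsum (Phi2 f) (Phi3 f).

(* Main.v *)
Require Import Defs.
From Stdlib Require Import Reals Lra Lia Arith.
From Stdlib Require Import Classical ClassicalEpsilon FunctionalExtensionality.
(* [Reals] rebinds [C] to the binomial coefficient. *)
Import Defs.
Open Scope R_scope.

(** The first extension is given by diagonal operators [x n |-> f (t n) x n] with [t] dense and
    taking each value infinitely often. For the second one, cut the index set into blocks of size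
    [2^K], seen as cubes [{-1,1}^K], and on block [K] let [f] act on the [i]-th Rademacher function
    [r i] ([i < K]) by [f (t i)] and on their orthogonal complement by a constant [f (t 0)].
    Khintchine's inequality and its dual make this bounded on [l^p] for [1 < p].

    Let [f j], [j < n], have disjoint supports and [f j (t (i j)) = 1]. For the diagonal extension
    [|sum_j f j y|^p = sum_j |f j y|^p]. For the second extension, applied to the sum of the
    (normalised) functions [r (i j)] in block [K], the left side is of order [n^(p/2)] and the right
    side is [n]. These vectors are disjointly supported as [K] grows, hence compact perturbations
    are negligible on them as [p > 1], and an equivalence, even after adding a third
    extension, would give [n^(p/2) ~ n] for all [n]; so [p = 2].

    Only the quasi-triangle inequality [|x + y|^p <= 2^p (|x|^p + |y|^p)] is needed, so estimates
    are stated for the energy [sum_n |x n|^p], in the form [lp_le p x B]. *)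

(** * Finite sums *)

Fixpoint rsum (n : nat) (f : nat -> R) : R :=
  match n with O => 0 | S m => rsum m f + f m end.

Lemma rsum_ext n f g : (forall i, (i < n)%nat -> f i = g i) -> rsum n f = rsum n g.
Proof.
  induction n as [|n IH]; intros H; simpl; [reflexivity|].
  rewrite IH by (intros; apply H; lia). rewrite H by lia. reflexivity.
Qed.

Lemma rsum_le n f g : (forall i, (i < n)%nat -> f i <= g i) -> rsum n f <= rsum n g.
Proof.
  induction n as [|n IH]; intros H; simpl; [lra|].
  apply Rplus_le_compat; [apply IH; intros|]; apply H; lia.
Qed.

Lemma rsum_plus n f g : rsum n (fun i => f i + g i) = rsum n f + rsum n g.
Proof. induction n as [|n IH]; simpl; [|rewrite IH]; ring. Qed.

Lemma rsum_scal n a f : rsum n (fun i => a * f i) = a * rsum n f.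
Proof. induction n as [|n IH]; simpl; [|rewrite IH]; ring. Qed.

Lemma rsum_const n a : rsum n (fun _ => a) = INR n * a.
Proof. induction n as [|n IH]; [simpl; ring|]. rewrite S_INR; simpl; rewrite IH; ring. Qed.

Lemma rsum_0 n f : (forall i, (i < n)%nat -> f i = 0) -> rsum n f = 0.
Proof. intros H. rewrite (rsum_ext n f (fun _ => 0) H), rsum_const. ring. Qed.

Lemma rsum_nonneg n f : (forall i, (i < n)%nat -> 0 <= f i) -> 0 <= rsum n f.
Proof.
  intros H. rewrite <- (rsum_0 n (fun _ => 0)) by reflexivity. now apply rsum_le.
Qed.

Lemma rsum_split m n f : rsum (m + n) f = rsum m f + rsum n (fun i => f (m + i)%nat).
Proof.
  induction n as [|n IH]; simpl.
  - rewrite Nat.add_0_r. ring.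
  - rewrite Nat.add_succ_r. simpl. rewrite IH. ring.
Qed.

Lemma rsum_mono m n f : (m <= n)%nat -> (forall i, 0 <= f i) -> rsum m f <= rsum n f.
Proof.
  intros Hmn Hf. replace n with (m + (n - m))%nat by lia. rewrite rsum_split.
  assert (0 <= rsum (n - m) (fun i => f (m + i)%nat)) by (apply rsum_nonneg; auto). lra.
Qed.

Lemma rsum_shift n f : rsum (S n) f = f 0%nat + rsum n (fun i => f (S i)).
Proof. change (S n) with (1 + n)%nat. rewrite rsum_split. simpl. ring. Qed.

Lemma rsum_double n f :
  rsum (2 * n) f = rsum n (fun j => f (2 * j)%nat + f (S (2 * j))).
Proof.
  induction n as [|n IH]; [reflexivity|].
  replace (2 * S n)%nat with (S (S (2 * n))) by lia. cbn [rsum]. rewrite IH. ring.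
Qed.

Lemma rsum_single n i f :
  (i < n)%nat -> (forall j, (j < n)%nat -> j <> i -> f j = 0) -> rsum n f = f i.
Proof.
  induction n as [|n IH]; intros Hi H; [lia|]. simpl.
  destruct (Nat.eq_dec i n) as [ -> |Hne].
  - rewrite rsum_0; [ring|]. intros j Hj. apply H; lia.
  - rewrite IH by (try lia; intros; apply H; lia). rewrite (H n) by lia. ring.
Qed.

Lemma rsum_exchange m n (f : nat -> nat -> R) :
  rsum m (fun i => rsum n (f i)) = rsum n (fun j => rsum m (fun i => f i j)).
Proof.
  induction m as [|m IH]; simpl.
  - symmetry. now apply rsum_0.
  - rewrite IH, <- rsum_plus. reflexivity.
Qed.

Lemma rsum_term_le n i f :
  (i < n)%nat -> (forall j, 0 <= f j) -> f i <= rsum n f.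
Proof.
  intros Hi Hf. apply Rle_trans with (rsum (S i) f).
  - simpl. assert (0 <= rsum i f) by (apply rsum_nonneg; auto). lra.
  - apply rsum_mono; auto.
Qed.

(** At most one [a i] is nonzero, so both sides reduce to [phi] of that term. Used with
    [phi u = u^p] for functions with disjoint supports. *)
Lemma rsum_disjoint n (phi : R -> R) a :
  phi 0 = 0 ->
  (forall i j, (i < n)%nat -> (j < n)%nat -> i <> j -> a i = 0 \/ a j = 0) ->
  rsum n (fun i => phi (a i)) = phi (rsum n a).
Proof.
  intros Hphi. induction n as [|n IH]; intros H; simpl; [now rewrite Hphi|].
  destruct (Req_dec (a n) 0) as [E|E].
  - rewrite E, Hphi, IH by (intros; apply H; lia). now rewrite !Rplus_0_r.
  - assert (Z : forall i, (i < n)%nat -> a i = 0).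
    { intros i Hi. destruct (H i n) as [K|K]; try lia; [exact K|contradiction]. }
    rewrite !rsum_0; [now rewrite !Rplus_0_l|exact Z|].
    intros i Hi. now rewrite Z.
Qed.

Lemma eventually_forall_lt (P : nat -> nat -> Prop) n :
  (forall j, (j < n)%nat -> exists N, forall m, (N <= m)%nat -> P j m) ->
  exists N, forall m, (N <= m)%nat -> forall j, (j < n)%nat -> P j m.
Proof.
  induction n as [|n IH]; intros H; [exists O; intros; lia|].
  destruct IH as [N1 H1]; [intros; apply H; lia|].
  destruct (H n) as [N2 H2]; [lia|].
  exists (Nat.max N1 N2). intros m Hm j Hj.
  destruct (Nat.eq_dec j n) as [ -> |]; [apply H2|apply H1]; lia.
Qed.

Lemma INR_pow2 k : INR (2 ^ k) = 2 ^ k.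
Proof. rewrite pow_INR. f_equal. Qed.

(** The powers of y/x > 1 are unbounded. This yields two contradictions: 2 against 2^p for compact
    operators, and 2 against 2^(p/2) at the end. *)
Lemma geometric_gap x y A : 0 < x < y -> ~ (forall k, y ^ k <= A * x ^ k).
Proof.
  intros [Hx Hxy] H.
  destruct (Pow_x_infinity (y / x)) with (b := A + 1) as [N HN].
  { rewrite Rabs_pos_eq.
    - apply Rmult_gt_reg_r with x; [lra|]. unfold Rdiv. rewrite Rmult_assoc, Rinv_l by lra. lra.
    - apply Rlt_le, Rdiv_lt_0_compat; lra. }
  specialize (HN N (le_n N)). specialize (H N).
  assert (P : 0 < x ^ N) by (apply pow_lt; lra).
  unfold Rdiv in HN. rewrite Rpow_mult_distr, pow_inv in HN.
  rewrite Rabs_pos_eq in HN.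
  2:{ apply Rmult_le_pos; [apply pow_le; lra|apply Rlt_le, Rinv_0_lt_compat, P]. }
  assert (y ^ N * / x ^ N <= A).
  { apply Rmult_le_reg_r with (x ^ N); [exact P|].
    rewrite Rmult_assoc, Rinv_l by lra. lra. }
  lra.
Qed.

(** * Powers *)

Lemma rpow_nonneg x p : 0 <= rpow x p.
Proof.
  unfold rpow. destruct (Rlt_dec 0 x); [|lra]. unfold Rpower. apply Rlt_le, exp_pos.
Qed.

Lemma rpow_pos x p : 0 < x -> 0 < rpow x p.
Proof.
  intros. unfold rpow. destruct (Rlt_dec 0 x); [|lra]. unfold Rpower. apply exp_pos.
Qed.

Lemma rpow_Rpower x p : 0 < x -> rpow x p = Rpower x p.
Proof. intros. unfold rpow. destruct (Rlt_dec 0 x); [reflexivity|lra]. Qed.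

Lemma rpow_0 p : rpow 0 p = 0.
Proof. unfold rpow. destruct (Rlt_dec 0 0); [lra|reflexivity]. Qed.

Lemma rpow_1 p : rpow 1 p = 1.
Proof. rewrite rpow_Rpower by lra. unfold Rpower. now rewrite ln_1, Rmult_0_r, exp_0. Qed.

Lemma rpow_id x : 0 <= x -> rpow x 1 = x.
Proof.
  intros [H| <- ]; [|apply rpow_0]. rewrite rpow_Rpower by exact H. now apply Rpower_1.
Qed.

Lemma rpow_mult x y p : 0 <= x -> 0 <= y -> rpow (x * y) p = rpow x p * rpow y p.
Proof.
  intros [Hx| <- ] [Hy| <- ]; rewrite ?Rmult_0_l, ?Rmult_0_r, ?rpow_0; try ring.
  rewrite !rpow_Rpower by (try apply Rmult_lt_0_compat; assumption).
  symmetry. now apply Rpower_mult_distr.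
Qed.

Lemma rpow_lt x y p : 0 < p -> 0 <= x -> x < y -> rpow x p < rpow y p.
Proof.
  intros Hp [Hx| <- ] Hxy; [|rewrite rpow_0; now apply rpow_pos].
  rewrite !rpow_Rpower by lra. unfold Rpower. apply exp_increasing.
  apply Rmult_lt_compat_l; [exact Hp|]. now apply ln_increasing.
Qed.

Lemma rpow_le x y p : 0 < p -> 0 <= x -> x <= y -> rpow x p <= rpow y p.
Proof. intros Hp Hx [H | -> ]; [apply Rlt_le, rpow_lt; assumption|lra]. Qed.

Lemma rpow_le_inv x y p : 0 < p -> 0 <= y -> rpow x p <= rpow y p -> x <= y.
Proof.
  intros Hp Hy H. destruct (Rle_lt_dec x y) as [|L]; [assumption|].
  pose proof (rpow_lt y x p Hp Hy L). lra.
Qed.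

Lemma rpow_rpow x a b : rpow (rpow x a) b = rpow x (a * b).
Proof.
  destruct (Rlt_dec 0 x) as [H|H].
  - rewrite (rpow_Rpower (rpow x a)) by now apply rpow_pos.
    rewrite !rpow_Rpower by exact H. apply Rpower_mult.
  - unfold rpow at 2 3. destruct (Rlt_dec 0 x); [contradiction|]. apply rpow_0.
Qed.

Lemma rpow_root x p : 0 < p -> 0 <= x -> rpow (rpow x (/ p)) p = x.
Proof. intros. rewrite rpow_rpow, Rinv_l by lra. now apply rpow_id. Qed.

Lemma rpow_pow x k p : 0 <= x -> rpow (x ^ k) p = rpow x p ^ k.
Proof.
  intros Hx. induction k as [|k IH]; simpl; [apply rpow_1|].
  rewrite rpow_mult, IH; auto using pow_le.
Qed.

Lemma rpow_add_le x y p :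
  0 < p -> 0 <= x -> 0 <= y -> rpow (x + y) p <= rpow 2 p * (rpow x p + rpow y p).
Proof.
  intros Hp Hx Hy. pose proof (rpow_nonneg x p). pose proof (rpow_nonneg y p).
  pose proof (rpow_nonneg 2 p).
  destruct (Rle_dec x y).
  - apply Rle_trans with (rpow (2 * y) p); [apply rpow_le; lra|].
    rewrite rpow_mult by lra. apply Rmult_le_compat_l; lra.
  - apply Rle_trans with (rpow (2 * x) p); [apply rpow_le; lra|].
    rewrite rpow_mult by lra. apply Rmult_le_compat_l; lra.
Qed.

Lemma rpow_2_ge1 p : 0 < p -> 1 <= rpow 2 p.
Proof. intros. rewrite <- (rpow_1 p). apply rpow_le; lra. Qed.

(** Raise u <= exp u, at u = x/p, to the power p. An exponential moment thus controls a p-th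
    moment. *)
Lemma rpow_le_exp p x : 0 < p -> 0 <= x -> rpow x p <= rpow p p * exp x.
Proof.
  intros Hp Hx.
  assert (H : x <= p * exp (x / p)).
  { pose proof (exp_ineq1_le (x / p)).
    replace x with (p * (x / p)) at 1 by (field; lra).
    apply Rmult_le_compat_l; lra. }
  apply Rle_trans with (rpow (p * exp (x / p)) p); [now apply rpow_le|].
  rewrite rpow_mult by (try lra; apply Rlt_le, exp_pos).
  rewrite (rpow_Rpower (exp _)) by apply exp_pos.
  unfold Rpower. rewrite ln_exp. right. do 2 f_equal. field. lra.
Qed.

(** Young's inequality with both constants relaxed to 1: if b <= a^(p-1) then ab <= a^p, and
    otherwise a <= b^(1/(p-1)) gives ab <= b^(p/(p-1)). *)
Lemma young_crude p a b :
  1 < p -> 0 <= a -> 0 <= b -> a * b <= rpow a p + rpow b (p / (p - 1)).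
Proof.
  intros Hp Ha Hb. pose proof (rpow_nonneg a p). pose proof (rpow_nonneg b (p / (p - 1))).
  destruct (Rle_dec b (rpow a (p - 1))) as [L|L].
  - assert (a * b <= rpow a p); [|lra].
    destruct Ha as [Ha| <- ]; [|lra].
    apply Rle_trans with (a * rpow a (p - 1)); [apply Rmult_le_compat_l; lra|].
    right. rewrite !rpow_Rpower by exact Ha.
    rewrite <- (Rpower_1 a Ha) at 1. rewrite <- Rpower_plus. f_equal. ring.
  - assert (a * b <= rpow b (p / (p - 1))); [|lra].
    pose proof (rpow_nonneg a (p - 1)). assert (Hb' : 0 < b) by lra.
    assert (A : a <= rpow b (/ (p - 1))).
    { apply rpow_le_inv with (p - 1); [lra|apply rpow_nonneg|].
      rewrite rpow_root; lra. }
    apply Rle_trans with (rpow b (/ (p - 1)) * b); [apply Rmult_le_compat_r; lra|].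
    right. rewrite !rpow_Rpower by exact Hb'.
    rewrite <- (Rpower_1 b Hb') at 2. rewrite <- Rpower_plus. f_equal. field. lra.
Qed.

(** * Complex numbers *)

Definition RtoC (r : R) : C := (r, 0).

Lemma C_ring : ring_theory C0 C1 Cadd Cmul (fun z w => Cadd z (Copp w)) Copp eq.
Proof.
  split; intros; unfold C0, C1, Cadd, Cmul, Copp;
    repeat match goal with z : C |- _ => destruct z end;
    simpl; f_equal; ring.
Qed.

Add Ring C_ring_inst : C_ring.

Lemma Cabs_nonneg z : 0 <= Cabs z.
Proof. apply sqrt_pos. Qed.

Lemma Cabs_sqr z : Cabs z * Cabs z = fst z ^ 2 + snd z ^ 2.
Proof. apply sqrt_sqrt. nra. Qed.

Lemma Cabs_RtoC r : Cabs (RtoC r) = Rabs r.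
Proof.
  unfold Cabs; simpl. rewrite <- sqrt_Rsqr_abs. f_equal. unfold Rsqr. ring.
Qed.

Lemma Cabs_C0 : Cabs C0 = 0.
Proof. change C0 with (RtoC 0). now rewrite Cabs_RtoC, Rabs_R0. Qed.

Lemma Cabs_C1 : Cabs C1 = 1.
Proof. change C1 with (RtoC 1). now rewrite Cabs_RtoC, Rabs_R1. Qed.

Lemma Cabs_eq_0 z : Cabs z = 0 -> z = C0.
Proof.
  intros H. pose proof (Cabs_sqr z) as E. rewrite H in E. destruct z as [a b]; simpl in E.
  unfold C0. f_equal; nra.
Qed.

Lemma Cabs_mul z w : Cabs (Cmul z w) = Cabs z * Cabs w.
Proof.
  unfold Cabs. rewrite <- sqrt_mult by nra. f_equal. unfold Cmul; simpl. ring.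
Qed.

Lemma Cabs_opp z : Cabs (Copp z) = Cabs z.
Proof. unfold Cabs, Copp; simpl. f_equal. ring. Qed.

Lemma Cabs_triang z w : Cabs (Cadd z w) <= Cabs z + Cabs w.
Proof.
  pose proof (Cabs_nonneg z). pose proof (Cabs_nonneg w).
  pose proof (Cabs_sqr z) as Ez. pose proof (Cabs_sqr w) as Ew.
  pose proof (Cabs_sqr (Cadd z w)) as E.
  (* Cauchy-Schwarz: the left side is the real part of [z] times the conjugate of [w]. *)
  assert (CS : fst z * fst w + snd z * snd w <= Cabs z * Cabs w).
  { pose proof (Cabs_mul z (fst w, - snd w)) as M.
    assert (W : Cabs (fst w, - snd w) = Cabs w) by (unfold Cabs; simpl; f_equal; ring).
    rewrite W in M. rewrite <- M.
    pose proof (Cabs_sqr (Cmul z (fst w, - snd w))) as Q. simpl in Q.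
    pose proof (Cabs_nonneg (Cmul z (fst w, - snd w))).
    destruct (Rle_dec (fst z * fst w + snd z * snd w) 0); [lra|].
    apply Rsqr_incr_0_var; [|assumption]. unfold Rsqr. rewrite Q.
    pose proof (pow2_ge_0 (fst z * - snd w + snd z * fst w)). lra. }
  apply Rsqr_incr_0_var; [|lra]. unfold Rsqr. rewrite E. unfold Cadd; simpl. nra.
Qed.

Lemma Rabs_fst_le z : Rabs (fst z) <= Cabs z.
Proof.
  rewrite <- sqrt_Rsqr_abs. apply sqrt_le_1_alt. unfold Rsqr. nra.
Qed.

Lemma Rabs_snd_le z : Rabs (snd z) <= Cabs z.
Proof.
  rewrite <- sqrt_Rsqr_abs. apply sqrt_le_1_alt. unfold Rsqr. nra.
Qed.

Lemma Cabs_le_components z : Cabs z <= Rabs (fst z) + Rabs (snd z).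
Proof.
  pose proof (Cabs_triang (RtoC (fst z)) (0, snd z)) as H.
  rewrite Cabs_RtoC in H.
  replace (Cabs (0, snd z)) with (Rabs (snd z)) in H.
  - replace (Cadd (RtoC (fst z)) (0, snd z)) with z in H; [exact H|].
    destruct z; unfold Cadd; simpl. f_equal; ring.
  - rewrite <- sqrt_Rsqr_abs. unfold Cabs; simpl. f_equal. unfold Rsqr. ring.
Qed.

Fixpoint csum (n : nat) (f : nat -> C) : C :=
  match n with O => C0 | S m => Cadd (csum m f) (f m) end.

Lemma csum_ext n f g : (forall i, (i < n)%nat -> f i = g i) -> csum n f = csum n g.
Proof.
  induction n as [|n IH]; intros H; simpl; [reflexivity|].
  rewrite IH by (intros; apply H; lia). rewrite H by lia. reflexivity.
Qed.

Lemma csum_add n f g : csum n (fun i => Cadd (f i) (g i)) = Cadd (csum n f) (csum n g).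
Proof. induction n as [|n IH]; simpl; [|rewrite IH]; ring. Qed.

Lemma csum_scal n a f : csum n (fun i => Cmul a (f i)) = Cmul a (csum n f).
Proof. induction n as [|n IH]; simpl; [|rewrite IH]; ring. Qed.

Lemma csum_0 n f : (forall i, (i < n)%nat -> f i = C0) -> csum n f = C0.
Proof.
  induction n as [|n IH]; intros H; simpl; [reflexivity|].
  rewrite IH by (intros; apply H; lia). rewrite H by lia. ring.
Qed.

Lemma fst_csum n f : fst (csum n f) = rsum n (fun i => fst (f i)).
Proof. induction n as [|n IH]; simpl; [|rewrite IH]; reflexivity. Qed.

Lemma snd_csum n f : snd (csum n f) = rsum n (fun i => snd (f i)).
Proof. induction n as [|n IH]; simpl; [|rewrite IH]; reflexivity. Qed.

Lemma csum_RtoC n f : csum n (fun i => RtoC (f i)) = RtoC (rsum n f).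
Proof.
  induction n as [|n IH]; simpl; [|rewrite IH]; unfold RtoC, Cadd, C0; simpl; f_equal; ring.
Qed.

Lemma RtoC_mul a b : RtoC (a * b) = Cmul (RtoC a) (RtoC b).
Proof. unfold RtoC, Cmul; simpl. f_equal; ring. Qed.

(** * Energy bounds in l^p *)

Definition lp_le (p : R) (x : seqC) (B : R) : Prop :=
  forall N, rsum N (fun n => rpow (Cabs (x n)) p) <= B.

Lemma psum_rsum p x N : psum p x N = rsum (S N) (fun n => rpow (Cabs (x n)) p).
Proof.
  unfold psum. induction N as [|N IH]; [simpl; ring|].
  simpl sum_f_R0. rewrite IH. reflexivity.
Qed.

Lemma psum_growing p x : Un_growing (psum p x).
Proof. intros n. simpl. pose proof (rpow_nonneg (Cabs (x (S n))) p). unfold psum. simpl. lra. Qed.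

Lemma lp_le_psum p x B : (forall N, psum p x N <= B) -> lp_le p x B.
Proof.
  intros H N. apply Rle_trans with (rsum (S N) (fun n => rpow (Cabs (x n)) p)).
  - apply rsum_mono; [lia|]. intros; apply rpow_nonneg.
  - rewrite <- psum_rsum. apply H.
Qed.

Lemma lp_le_in_lp p x B : lp_le p x B -> in_lp p x.
Proof.
  intros H. destruct (growing_cv (psum p x) (psum_growing p x)) as [l Hl].
  - exists B. intros y [N ->]. rewrite psum_rsum. apply H.
  - now exists l.
Qed.

Lemma in_lp_lp_le p x : in_lp p x -> exists B, lp_le p x B.
Proof.
  intros [l Hl]. exists l. apply lp_le_psum. intros N.
  apply growing_ineq; [apply psum_growing|exact Hl].
Qed.

Lemma lp_le_norm p x r : lp_norm_is p x r -> lp_le p x (rpow r p).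
Proof.
  intros [_ H]. apply lp_le_psum. intros N. apply growing_ineq; [apply psum_growing|exact H].
Qed.

Lemma lp_le_nonneg p x B : lp_le p x B -> 0 <= B.
Proof. intros H. exact (H O). Qed.

Lemma norm_le_energy p x r B : lp_norm_is p x r -> lp_le p x B -> rpow r p <= B.
Proof.
  intros [_ H] HB. destruct (Rle_lt_dec (rpow r p) B) as [|L]; [assumption|].
  destruct (H (rpow r p - B)) as [N HN]; [lra|].
  specialize (HN N (le_n N)). specialize (HB (S N)). rewrite <- psum_rsum in HB.
  unfold Rdist in HN. rewrite Rabs_left1 in HN; lra.
Qed.

Lemma in_lp_norm p x : 0 < p -> in_lp p x -> exists r, lp_norm_is p x r.
Proof.
  intros Hp [l Hl].
  assert (0 <= l).
  { pose proof (growing_ineq _ _ (psum_growing p x) Hl 0) as H. unfold psum in H; simpl in H.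
    pose proof (rpow_nonneg (Cabs (x O)) p). lra. }
  exists (rpow l (/ p)). split; [apply rpow_nonneg|]. now rewrite rpow_root.
Qed.

Lemma lp_le_weaken p x A B : lp_le p x A -> A <= B -> lp_le p x B.
Proof. intros H L N. specialize (H N). lra. Qed.

Lemma lp_le_coord p x B n : lp_le p x B -> rpow (Cabs (x n)) p <= B.
Proof.
  intros H. eapply Rle_trans; [|apply (H (S n))].
  apply (rsum_term_le (S n) n (fun n => rpow (Cabs (x n)) p)); [lia|].
  intros; apply rpow_nonneg.
Qed.

Lemma lp_le_pointwise p x y c B :
  0 <= c -> (forall n, rpow (Cabs (y n)) p <= c * rpow (Cabs (x n)) p) ->
  lp_le p x B -> lp_le p y (c * B).
Proof.
  intros Hc H HB N.
  apply Rle_trans with (rsum N (fun n => c * rpow (Cabs (x n)) p)); [now apply rsum_le|].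
  rewrite rsum_scal. now apply Rmult_le_compat_l.
Qed.

Lemma lp_le_vadd p x y A B :
  0 < p -> lp_le p x A -> lp_le p y B -> lp_le p (vadd x y) (rpow 2 p * (A + B)).
Proof.
  intros Hp HA HB N.
  apply Rle_trans with
    (rsum N (fun n => rpow 2 p * (rpow (Cabs (x n)) p + rpow (Cabs (y n)) p))).
  - apply rsum_le. intros n _. unfold vadd.
    apply Rle_trans with (rpow (Cabs (x n) + Cabs (y n)) p).
    + apply rpow_le; auto using Cabs_nonneg, Cabs_triang.
    + apply rpow_add_le; auto using Cabs_nonneg.
  - rewrite rsum_scal, rsum_plus. apply Rmult_le_compat_l; [apply rpow_nonneg|].
    specialize (HA N). specialize (HB N). lra.
Qed.

Lemma lp_le_vscal p a x A : lp_le p x A -> lp_le p (vscal a x) (rpow (Cabs a) p * A).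
Proof.
  apply lp_le_pointwise; [apply rpow_nonneg|]. intros n. unfold vscal.
  rewrite Cabs_mul, rpow_mult by apply Cabs_nonneg. lra.
Qed.

Lemma vsub_vadd x y : vsub x y = vadd x (vscal (Copp C1) y).
Proof. extensionality n. unfold vsub, vadd, vscal. ring. Qed.

Lemma lp_le_vsub p x y A B :
  0 < p -> lp_le p x A -> lp_le p y B -> lp_le p (vsub x y) (rpow 2 p * (A + B)).
Proof.
  intros Hp HA HB. rewrite vsub_vadd. apply lp_le_vadd; try assumption.
  pose proof (lp_le_vscal p (Copp C1) y B HB) as H.
  now rewrite Cabs_opp, Cabs_C1, rpow_1, Rmult_1_l in H.
Qed.

Definition vzero : seqC := fun _ => C0.

Lemma lp_le_vzero p B : 0 <= B -> lp_le p vzero B.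
Proof.
  intros HB N. rewrite rsum_0; [exact HB|]. intros. unfold vzero. now rewrite Cabs_C0, rpow_0.
Qed.

Lemma vscal_C1 x : vscal C1 x = x.
Proof. extensionality n. unfold vscal. ring. Qed.

(** * Operators *)

(** Here [c] is the p-th power of an operator norm bound, which keeps roots out of the estimates. *)
Definition energy_bound (p : R) (T : op) (c : R) : Prop :=
  0 <= c /\ forall x B, lp_le p x B -> lp_le p (T x) (c * B).

Definition linear_op (p : R) (T : op) : Prop :=
  forall (a b : C) x y, in_lp p x -> in_lp p y ->
    T (vadd (vscal a x) (vscal b y)) = vadd (vscal a (T x)) (vscal b (T y)).

Lemma opnorm_le_energy p T c :
  0 < p -> 0 <= c -> energy_bound p T (rpow c p) -> opnorm_le p T c.
Proof.
  intros Hp Hc [_ H] x r s Hr Hs.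
  pose proof (norm_le_energy _ _ _ _ Hs (H _ _ (lp_le_norm _ _ _ Hr))) as L.
  destruct Hr as [Hr _].
  rewrite <- rpow_mult in L by assumption.
  apply rpow_le_inv with p; auto using Rmult_le_pos.
Qed.

Lemma bounded_op_energy p T c : 0 < p -> linear_op p T -> energy_bound p T c -> bounded_op p T.
Proof.
  intros Hp HL [Hc H]. split; [|split].
  - intros x Hx. destruct (in_lp_lp_le _ _ Hx) as [B HB]. eapply lp_le_in_lp, H, HB.
  - exact HL.
  - exists (rpow c (/ p)). apply opnorm_le_energy; [exact Hp|apply rpow_nonneg|].
    rewrite rpow_root by assumption. now split.
Qed.

(** The definition of [opnorm_le] puts no sign condition on its constant, whence [Rmax c 0]. *)
Lemma energy_of_opnorm_le p T c :
  0 < p -> (forall x, in_lp p x -> in_lp p (T x)) -> opnorm_le p T c ->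
  energy_bound p T (rpow (Rmax c 0) p).
Proof.
  intros Hp Hin Hc. split; [apply rpow_nonneg|]. intros x B HB.
  pose proof (lp_le_in_lp _ _ _ HB) as Hx.
  destruct (in_lp_norm p x Hp Hx) as [r Hr].
  destruct (in_lp_norm p (T x) Hp (Hin x Hx)) as [s Hs].
  pose proof (Hc x r s Hr Hs) as L.
  pose proof (norm_le_energy _ _ _ _ Hr HB) as LB.
  apply lp_le_weaken with (rpow s p); [now apply lp_le_norm|].
  apply Rle_trans with (rpow (Rmax c 0 * r) p).
  - destruct Hs as [Hs _], Hr as [Hr _]. apply rpow_le; auto.
    apply Rle_trans with (c * r); [exact L|]. apply Rmult_le_compat_r; auto using Rmax_l.
  - destruct Hr as [Hr _]. rewrite rpow_mult by (auto using Rmax_r).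
    apply Rmult_le_compat_l; auto using rpow_nonneg.
Qed.

Lemma bounded_op_has_energy p T : 0 < p -> bounded_op p T -> exists c, energy_bound p T c.
Proof.
  intros Hp [Hin [_ [M HM]]]. eexists. apply energy_of_opnorm_le; eassumption.
Qed.

Lemma linear_vadd p T x y :
  linear_op p T -> in_lp p x -> in_lp p y -> T (vadd x y) = vadd (T x) (T y).
Proof.
  intros H Hx Hy. specialize (H C1 C1 x y Hx Hy). now rewrite !vscal_C1 in H.
Qed.

Lemma in_lp_vzero p : in_lp p vzero.
Proof. apply lp_le_in_lp with 0. apply lp_le_vzero. lra. Qed.

Lemma linear_vzero p T : linear_op p T -> T vzero = vzero.
Proof.
  intros H. specialize (H C0 C0 vzero vzero (in_lp_vzero p) (in_lp_vzero p)).
  replace (vadd (vscal C0 vzero) (vscal C0 vzero)) with vzero in H.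
  - rewrite H. extensionality n. unfold vadd, vscal, vzero. ring.
  - extensionality n. unfold vadd, vscal, vzero. ring.
Qed.

(** Vanishing is asked on l^p only, since values of an [op] elsewhere carry no information. Exact
    identities between lifts become compact differences this way. *)
Lemma compact_op_zero p T : 0 < p -> op_eq p T (fun _ => vzero) -> compact_op p T.
Proof.
  intros Hp H. split.
  - apply bounded_op_energy with 0; [exact Hp| |split; [lra|]].
    + intros a b x y [A HA]%in_lp_lp_le [B HB]%in_lp_lp_le.
      rewrite !H; [|eapply lp_le_in_lp; eassumption|eapply lp_le_in_lp; eassumption|].
      * extensionality n. unfold vadd, vscal, vzero. ring.
      * eapply lp_le_in_lp, lp_le_vadd; auto; apply lp_le_vscal; eassumption.
    + intros x B HB. rewrite H by (eapply lp_le_in_lp; eassumption). apply lp_le_vzero. lra.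
  - intros xs M Hxs. exists (fun k => k), vzero. split; [intros; lia|].
    split; [apply in_lp_vzero|]. intros eps He. exists O. intros k _ r Hr.
    rewrite H in Hr by apply Hxs.
    apply Rle_lt_trans with 0; [|exact He]. apply rpow_le_inv with p; [exact Hp|lra|].
    rewrite rpow_0. apply (norm_le_energy p _ r 0 Hr).
    rewrite vsub_vadd. replace (vadd _ _) with vzero; [apply lp_le_vzero; lra|].
    extensionality n. unfold vadd, vscal, vzero. ring.
Qed.

(** * Compact operators on disjointly supported sequences *)

Definition disjoint_seq (x : nat -> seqC) : Prop :=
  forall j k n, j <> k -> x j n = C0 \/ x k n = C0.

Definition vsum (m : nat) (x : nat -> seqC) : seqC := fun n => csum m (fun k => x k n).

(** Each coordinate meets at most one nonzero summand, so the energies add. *)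
Lemma lp_le_vsum_disjoint p x B m :
  disjoint_seq x -> (forall k, lp_le p (x k) B) -> lp_le p (vsum m x) (INR m * B).
Proof.
  intros Hd HB. induction m as [|m IH].
  - simpl INR. rewrite Rmult_0_l. now apply lp_le_vzero.
  - intros N. rewrite S_INR.
    apply Rle_trans with (rsum N (fun n => rpow (Cabs (vsum m x n)) p + rpow (Cabs (x m n)) p)).
    + apply rsum_le. intros n _. change (vsum (S m) x n) with (Cadd (vsum m x n) (x m n)).
      destruct (classic (x m n = C0)) as [E|E].
      * rewrite E, Cabs_C0, rpow_0. replace (Cadd _ _) with (vsum m x n) by ring. lra.
      * assert (Z : vsum m x n = C0).
        { apply csum_0. intros k Hk. destruct (Hd k m n) as [K|K]; [lia|exact K|contradiction]. }
        rewrite Z, Cabs_C0, rpow_0. replace (Cadd _ _) with (x m n) by ring. lra.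
    + rewrite rsum_plus. specialize (IH N). specialize (HB m N). lra.
Qed.

Lemma linear_vsum p T x B m :
  linear_op p T -> disjoint_seq x -> (forall k, lp_le p (x k) B) ->
  T (vsum m x) = vsum m (fun k => T (x k)).
Proof.
  intros HT Hd HB. induction m as [|m IH].
  - apply (linear_vzero p T HT).
  - change (vsum (S m) x) with (vadd (vsum m x) (x m)).
    rewrite (linear_vadd p), IH; [reflexivity|exact HT| |].
    + eapply lp_le_in_lp, lp_le_vsum_disjoint; eassumption.
    + eapply lp_le_in_lp, HB.
Qed.

(** The sum lies within m d of m y; the reverse triangle inequality turns this into linear growth in
    m. *)
Lemma csum_close m (f : nat -> C) y d :
  (forall k, Cabs (Cadd (f k) (Copp y)) <= d) ->
  INR m * (Cabs y - d) <= Cabs (csum m f).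
Proof.
  intros H.
  assert (E : Cabs (Cadd (csum m f) (Copp (Cmul (RtoC (INR m)) y))) <= INR m * d).
  { induction m as [|m IH].
    - simpl. replace (Cadd _ _) with C0 by (unfold RtoC; fold C0; ring). rewrite Cabs_C0. lra.
    - simpl csum. rewrite S_INR.
      replace (Cadd _ _) with
        (Cadd (Cadd (csum m f) (Copp (Cmul (RtoC (INR m)) y))) (Cadd (f m) (Copp y))).
      + eapply Rle_trans; [apply Cabs_triang|]. specialize (H m). lra.
      + replace (RtoC (INR m + 1)) with (Cadd (RtoC (INR m)) C1); [ring|].
        unfold RtoC, Cadd, C1; simpl. f_equal. ring. }
  pose proof (Cabs_triang (csum m f)
    (Copp (Cadd (csum m f) (Copp (Cmul (RtoC (INR m)) y))))) as T.
  rewrite Cabs_opp in T.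
  replace (Cadd (csum m f) _) with (Cmul (RtoC (INR m)) y) in T by ring.
  rewrite Cabs_mul, Cabs_RtoC, Rabs_pos_eq in T by apply pos_INR. lra.
Qed.

Lemma strictly_increasing_lt (g : nat -> nat) :
  (forall k, (g k < g (S k))%nat) -> forall j k, (j < k)%nat -> (g j < g k)%nat.
Proof.
  intros H j k. induction 1 as [|k _ IH]; [apply H|]. specialize (H k). lia.
Qed.

Lemma strictly_increasing_inj (g : nat -> nat) :
  (forall k, (g k < g (S k))%nat) -> forall j k, j <> k -> g j <> g k.
Proof.
  intros H j k Hjk. destruct (Nat.lt_trichotomy j k) as [L|[L|L]]; [|lia|];
    apply (strictly_increasing_lt g H) in L; lia.
Qed.

Lemma frequently_subsequence (P : nat -> Prop) :
  (forall N, exists k, (N <= k)%nat /\ P k) ->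
  exists h : nat -> nat, (forall k, (h k < h (S k))%nat) /\ forall k, P (h k).
Proof.
  intros H.
  set (next := fun N => proj1_sig (constructive_indefinite_description _ (H N))).
  assert (Hn : forall N, (N <= next N)%nat /\ P (next N)).
  { intros N. exact (proj2_sig (constructive_indefinite_description _ (H N))). }
  exists (fix h k := match k with O => next O | S k => next (S (h k)) end). split.
  - intros k. cbn. apply Hn.
  - intros [|k]; cbn; apply Hn.
Qed.

(* A limit [y] of a subsequence of [K (x k)] would satisfy [m |y c| = O(|K (x 1 + ... + x m)|)],
   while disjointness gives [|x 1 + ... + x m| = O(m^(1/p))]; so [y = 0] because [p > 1]. *)
Lemma compact_disjoint_null p K x B :
  1 < p -> compact_op p K -> disjoint_seq x -> (forall k, lp_le p (x k) B) ->
  forall e, 0 < e -> exists k0, forall k, (k0 <= k)%nat -> lp_le p (K (x k)) e.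
Proof.
  intros Hp [Kb Kc] Hd HB e He.
  assert (Hp0 : 0 < p) by lra.
  assert (B0 : 0 <= B) by exact (lp_le_nonneg _ _ _ (HB O)).
  destruct (bounded_op_has_energy p K Hp0 Kb) as [c [Hc HK]].
  destruct Kb as [Kin [Klin _]].
  apply NNPP. intros Hno.
  (* If the energies did not tend to 0, a subsequence [h] would keep image energy above [e];
     compactness then extracts a limit [y] along [g]. *)
  destruct (frequently_subsequence (fun k => ~ lp_le p (K (x k)) e)) as [h [Hh Hbad]].
  { intros N. apply NNPP. intros Hn. apply Hno. exists N. intros k Hk. apply NNPP. intros L.
    apply Hn. now exists k. }
  destruct (Kc (fun k => x (h k)) (rpow B (/ p))) as [g [y [Hg [Hy Hlim]]]].
  { intros k. split; [eapply lp_le_in_lp, HB|]. intros r Hr.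
    apply rpow_le_inv with p; [exact Hp0|apply rpow_nonneg|].
    rewrite rpow_root by assumption. eapply norm_le_energy; [exact Hr|apply HB]. }
  destruct (in_lp_lp_le _ _ Hy) as [By HBy].
  assert (Hdiff : forall k, exists r, lp_norm_is p (vsub (K (x (h (g k)))) y) r).
  { intros k. apply in_lp_norm; [exact Hp0|].
    eapply lp_le_in_lp, lp_le_vsub; [exact Hp0|apply HK, HB|exact HBy]. }
  assert (Hy0 : y = vzero).
  { extensionality i. unfold vzero. apply NNPP. intros Hyi.
    set (eta := Cabs (y i)).
    assert (Heta : 0 < eta).
    { destruct (Cabs_nonneg (y i)) as [L|L]; [exact L|]. symmetry in L.
      now apply Cabs_eq_0 in L. }
    destruct (Hlim (eta / 2)) as [K0 HK0]; [lra|].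
    (* A tail along which coordinate [i] of [K (w k)] stays within eta/2 of [y i]. *)
    set (w := fun k => x (h (g (K0 + k)%nat))).
    assert (wd : disjoint_seq w).
    { intros j k n Hjk. apply Hd. apply strictly_increasing_inj; [exact Hh|].
      apply strictly_increasing_inj; [exact Hg|lia]. }
    assert (wB : forall k, lp_le p (w k) B) by (intros; apply HB).
    assert (Hm : forall m, rpow (INR m * (eta / 2)) p <= c * (INR m * B)).
    { intros m.
      pose proof (lp_le_coord p _ _ i (HK _ _ (lp_le_vsum_disjoint p w B m wd wB))) as L.
      eapply Rle_trans; [|exact L]. apply rpow_le; [exact Hp0| |].
      - apply Rmult_le_pos; [apply pos_INR|lra].
      - rewrite (linear_vsum p K w B m Klin wd wB).
        replace (eta / 2) with (Cabs (y i) - eta / 2) by (unfold eta; lra).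
        apply csum_close. intros k.
        destruct (Hdiff (K0 + k)%nat) as [r Hr].
        pose proof (HK0 (K0 + k)%nat ltac:(lia) r Hr) as Lr.
        apply Rle_trans with r; [|lra].
        apply rpow_le_inv with p; [exact Hp0|apply Hr|].
        exact (lp_le_coord p _ _ i (lp_le_norm _ _ _ Hr)). }
    (* With m = 2^k the estimate reads 2^(pk) = O(2^k), impossible because 2 < 2^p. *)
    apply (geometric_gap 2 (rpow 2 p) (c * B / rpow (eta / 2) p)).
    { split; [lra|]. rewrite rpow_Rpower by lra. rewrite <- (Rpower_1 2) at 1 by lra.
      apply Rpower_lt; lra. }
    intros k. specialize (Hm (2 ^ k)%nat). rewrite INR_pow2 in Hm.
    rewrite rpow_mult, rpow_pow in Hm by (try apply pow_le; lra).
    assert (P : 0 < rpow (eta / 2) p) by (apply rpow_pos; lra).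
    apply Rmult_le_reg_r with (rpow (eta / 2) p); [exact P|].
    replace (c * B / rpow (eta / 2) p * 2 ^ k * rpow (eta / 2) p) with (c * (2 ^ k * B))
      by (field; lra). exact Hm. }
  (* With [y = 0], some image along the subsequence has energy at most [e], contrary to the choice
     of [h]. *)
  destruct (Hlim (rpow e (/ p))) as [K0 HK0]; [now apply rpow_pos|].
  destruct (Hdiff K0) as [r Hr]. specialize (HK0 K0 (le_n _) r Hr).
  apply (Hbad (g K0)). rewrite Hy0 in Hr.
  replace (vsub (K (x (h (g K0)))) vzero) with (K (x (h (g K0)))) in Hr
    by (extensionality n; unfold vsub, vzero; ring).
  apply lp_le_weaken with (rpow r p); [now apply lp_le_norm|].
  rewrite <- (rpow_root e p) by lra. apply rpow_le; [exact Hp0|apply Hr|lra].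
Qed.

(** * Rademacher functions and Khintchine's inequality *)

(* The cube [{-1,1}^K] is [{0, ..., 2^K - 1}]; [rad i j] is the sign given by the binary digit
   of weight [2^i] of [j]. *)
Fixpoint rad (i j : nat) : R :=
  match i with
  | O => if Nat.even j then 1 else -1
  | S i => rad i (Nat.div2 j)
  end.

Definition lin (K : nat) (a : nat -> R) (j : nat) : R := rsum K (fun i => a i * rad i j).

Lemma rad_0_even j : rad 0 (2 * j) = 1.
Proof. unfold rad. now rewrite Nat.even_even. Qed.

Lemma rad_0_odd j : rad 0 (S (2 * j)) = -1.
Proof. unfold rad. rewrite <- Nat.add_1_r, Nat.even_odd. reflexivity. Qed.

Lemma rad_S_even i j : rad (S i) (2 * j) = rad i j.
Proof. change (rad i (Nat.div2 (2 * j)) = rad i j). now rewrite Nat.div2_double. Qed.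

Lemma rad_S_odd i j : rad (S i) (S (2 * j)) = rad i j.
Proof. change (rad i (Nat.div2 (S (2 * j))) = rad i j). now rewrite Nat.div2_succ_double. Qed.

Lemma Rabs_rad i : forall j, Rabs (rad i j) = 1.
Proof.
  induction i as [|i IH]; intros j; simpl; [|apply IH].
  destruct (Nat.even j); [apply Rabs_R1|]. rewrite Rabs_left; lra.
Qed.

Lemma lin_even K a j : lin (S K) a (2 * j) = a 0%nat + lin K (fun i => a (S i)) j.
Proof.
  unfold lin. rewrite rsum_shift, rad_0_even, Rmult_1_r. f_equal. apply rsum_ext. intros.
  now rewrite rad_S_even.
Qed.

Lemma lin_odd K a j : lin (S K) a (S (2 * j)) = - a 0%nat + lin K (fun i => a (S i)) j.
Proof.
  unfold lin. rewrite rsum_shift, rad_0_odd. f_equal; [ring|]. apply rsum_ext. intros.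
  now rewrite rad_S_odd.
Qed.

Lemma lin_scal K c a j : lin K (fun i => c * a i) j = c * lin K a j.
Proof.
  unfold lin. rewrite <- rsum_scal. apply rsum_ext. intros. ring.
Qed.

Lemma rsum_pow2_S K f :
  rsum (2 ^ S K) f = rsum (2 ^ K) (fun j => f (2 * j)%nat + f (S (2 * j))).
Proof. rewrite Nat.pow_succ_r'. apply rsum_double. Qed.

(** Induction on the lowest digit: 2j and 2j+1 share all digits above it and have opposite signs
    [rad 0], so products of [rad 0] with a higher function cancel in pairs. *)
Lemma rad_orthogonal K : forall i l, (i < K)%nat -> (l < K)%nat ->
  rsum (2 ^ K) (fun j => rad i j * rad l j) = if Nat.eq_dec i l then 2 ^ K else 0.
Proof.
  induction K as [|K IH]; intros i l Hi Hl; [lia|].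
  rewrite rsum_pow2_S. destruct i as [|i], l as [|l].
  - rewrite (rsum_ext _ _ (fun _ => 2)).
    + rewrite rsum_const, INR_pow2. simpl. ring.
    + intros j _. rewrite rad_0_even, rad_0_odd. ring.
  - apply rsum_0. intros j _. rewrite rad_0_even, rad_0_odd, rad_S_even, rad_S_odd. ring.
  - apply rsum_0. intros j _. rewrite rad_0_even, rad_0_odd, rad_S_even, rad_S_odd. ring.
  - rewrite (rsum_ext _ _ (fun j => 2 * (rad i j * rad l j))).
    + rewrite rsum_scal, IH by lia.
      destruct (Nat.eq_dec i l), (Nat.eq_dec (S i) (S l)); try lia; simpl; ring.
    + intros j _. rewrite !rad_S_even, !rad_S_odd. ring.
Qed.

(** The bound exp b <= 1/(1 - b) makes the sum at most 2/(1 - a^2), which is at most 2 (1 + 2 a^2)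
    when a^2 <= 1/2. *)
Lemma cosh_le_exp_sqr a : a ^ 2 <= / 2 -> exp a + exp (- a) <= 2 * exp (2 * a ^ 2).
Proof.
  intros H.
  assert (Ha : -1 < a < 1) by (split; nra).
  assert (E : forall b, b < 1 -> exp b <= / (1 - b)).
  { intros b Hb. rewrite <- (Ropp_involutive b) at 1. rewrite exp_Ropp.
    apply Rinv_le_contravar; [lra|]. pose proof (exp_ineq1_le (- b)). lra. }
  pose proof (E a ltac:(lra)) as E1. pose proof (E (- a) ltac:(lra)) as E2.
  pose proof (exp_ineq1_le (2 * a ^ 2)).
  apply Rle_trans with (/ (1 - a) + / (1 - - a)); [lra|].
  apply Rle_trans with (2 * (1 + 2 * a ^ 2)); [|lra].
  replace (/ (1 - a) + / (1 - - a)) with (2 / (1 - a ^ 2)) by (field; nra).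
  apply Rmult_le_reg_r with (1 - a ^ 2); [nra|].
  replace (2 / (1 - a ^ 2) * (1 - a ^ 2)) with 2 by (field; nra).
  pose proof (pow2_ge_0 a). nra.
Qed.

(** The signs are independent, so the exponential moment factorises; each digit contributes a factor
    bounded by [cosh_le_exp_sqr]. *)
Lemma exp_lin_sum_le K : forall a, rsum K (fun i => a i ^ 2) <= / 2 ->
  rsum (2 ^ K) (fun j => exp (lin K a j)) <= 2 ^ K * exp (2 * rsum K (fun i => a i ^ 2)).
Proof.
  induction K as [|K IH]; intros a Ha.
  - unfold lin. simpl. rewrite Rmult_0_r, exp_0. lra.
  - rewrite rsum_shift in *.
    pose proof (pow2_ge_0 (a 0%nat)) as P0.
    assert (P1 : 0 <= rsum K (fun i => a (S i) ^ 2))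
      by (apply rsum_nonneg; intros; apply pow2_ge_0).
    rewrite rsum_pow2_S.
    rewrite (rsum_ext _ _ (fun j => (exp (a 0%nat) + exp (- a 0%nat)) *
                                    exp (lin K (fun i => a (S i)) j))).
    2:{ intros j _. rewrite lin_even, lin_odd, !exp_plus. ring. }
    rewrite rsum_scal, Rmult_plus_distr_l, exp_plus.
    apply Rle_trans with
      (2 * exp (2 * a 0%nat ^ 2) * (2 ^ K * exp (2 * rsum K (fun i => a (S i) ^ 2)))).
    + apply Rmult_le_compat.
      * apply Rplus_le_le_0_compat; apply Rlt_le, exp_pos.
      * apply rsum_nonneg. intros. apply Rlt_le, exp_pos.
      * apply cosh_le_exp_sqr. lra.
      * apply IH. lra.
    + right. simpl. ring.
Qed.

(** The upper half of Khintchine's inequality, with a constant independent of [K]: after scaling,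
    |u|^p <= p^p (exp u + exp (-u)), and exponential moments of Rademacher sums are bounded. *)
Lemma khintchine p : 0 < p -> exists A, 0 < A /\ forall K a s, 0 <= s ->
  rsum K (fun i => a i ^ 2) <= s ^ 2 ->
  rsum (2 ^ K) (fun j => rpow (Rabs (lin K a j)) p) <= A * 2 ^ K * rpow s p.
Proof.
  intros Hp. exists (rpow 2 p * (rpow p p * (2 * exp 1))). split.
  { repeat apply Rmult_lt_0_compat; try apply rpow_pos; try apply exp_pos; lra. }
  intros K a s [Hs | <- ] Ha.
  (* Division by 2s brings the sum of squares down to 1/4, within the range of [exp_lin_sum_le]. *)
  - set (b := fun i => / (2 * s) * a i).
    assert (Hb : rsum K (fun i => b i ^ 2) <= / 2).
    { unfold b. rewrite (rsum_ext _ _ (fun i => / (4 * s ^ 2) * a i ^ 2)).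
      - rewrite rsum_scal. apply Rle_trans with (/ (4 * s ^ 2) * s ^ 2).
        + apply Rmult_le_compat_l; [|exact Ha]. apply Rlt_le, Rinv_0_lt_compat. nra.
        + replace (/ (4 * s ^ 2) * s ^ 2) with (/ 4) by (field; lra). lra.
      - intros. field. lra. }
    assert (Hb' : rsum K (fun i => (-1 * b i) ^ 2) <= / 2).
    { rewrite (rsum_ext _ _ (fun i => b i ^ 2)); [exact Hb|]. intros. ring. }
    assert (M : forall c, rsum K (fun i => c i ^ 2) <= / 2 ->
      rsum (2 ^ K) (fun j => exp (lin K c j)) <= 2 ^ K * exp 1).
    { intros c Hc. eapply Rle_trans; [now apply exp_lin_sum_le|].
      apply Rmult_le_compat_l; [apply pow_le; lra|].
      destruct (Req_dec (2 * rsum K (fun i => c i ^ 2)) 1) as [E|E]; [rewrite E; lra|].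
      apply Rlt_le, exp_increasing. lra. }
    apply Rle_trans with (rsum (2 ^ K) (fun j =>
      rpow (2 * s) p * (rpow p p * (exp (lin K b j) + exp (lin K (fun i => -1 * b i) j))))).
    + apply rsum_le. intros j _.
      replace (lin K a j) with ((2 * s) * lin K b j)
        by (unfold b; rewrite lin_scal; field; lra).
      rewrite Rabs_mult, (Rabs_pos_eq (2 * s)) by lra.
      rewrite rpow_mult by (try apply Rabs_pos; lra).
      apply Rmult_le_compat_l; [apply rpow_nonneg|].
      eapply Rle_trans; [apply rpow_le_exp; [exact Hp|apply Rabs_pos]|].
      apply Rmult_le_compat_l; [apply rpow_nonneg|].
      rewrite lin_scal. replace (-1 * lin K b j) with (- lin K b j) by ring.
      pose proof (exp_pos (lin K b j)). pose proof (exp_pos (- lin K b j)).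
      unfold Rabs. destruct (Rcase_abs _); lra.
    + rewrite !rsum_scal, rsum_plus, rpow_mult by lra.
      pose proof (M b Hb). pose proof (M _ Hb').
      pose proof (rpow_nonneg 2 p). pose proof (rpow_nonneg s p). pose proof (rpow_nonneg p p).
      replace (rpow 2 p * (rpow p p * (2 * exp 1)) * 2 ^ K * rpow s p) with
        (rpow 2 p * rpow s p * (rpow p p * (2 ^ K * exp 1 + 2 ^ K * exp 1))) by ring.
      apply Rmult_le_compat_l; [now apply Rmult_le_pos|].
      apply Rmult_le_compat_l; [assumption|lra].
  (* For s = 0 all coefficients vanish, and so does the sum. *)
  - assert (Z : forall i, (i < K)%nat -> a i = 0).
    { intros i Hi. pose proof (rsum_term_le K i (fun i => a i ^ 2) Hi
        (fun j => pow2_ge_0 (a j))) as L. simpl in L, Ha. nra. }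
    rewrite rpow_0, Rmult_0_r. right. apply rsum_0. intros j _.
    unfold lin. rewrite rsum_0; [now rewrite Rabs_R0, rpow_0|].
    intros i Hi. rewrite Z by exact Hi. ring.
Qed.

(** The coefficient of [rad i] in the orthogonal projection of [y], for the normalised counting
    measure on the cube. *)
Definition rcoef (K i : nat) (y : nat -> R) : R :=
  / 2 ^ K * rsum (2 ^ K) (fun j => rad i j * y j).

Lemma rsum_mul_lin K a y :
  rsum (2 ^ K) (fun j => y j * lin K a j) = 2 ^ K * rsum K (fun i => a i * rcoef K i y).
Proof.
  rewrite (rsum_ext _ _ (fun j => rsum K (fun i => a i * (rad i j * y j)))).
  - rewrite rsum_exchange, <- rsum_scal. apply rsum_ext. intros i _.
    rewrite rsum_scal. unfold rcoef. field. apply pow_nonzero. lra.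
  - intros j _. unfold lin. rewrite <- rsum_scal. apply rsum_ext. intros. ring.
Qed.

Lemma rcoef_lin K i a : (i < K)%nat -> rcoef K i (lin K a) = a i.
Proof.
  intros Hi. unfold rcoef.
  rewrite (rsum_ext _ _ (fun j => rsum K (fun l => a l * (rad i j * rad l j)))).
  2:{ intros j _. unfold lin. rewrite <- rsum_scal. apply rsum_ext. intros. ring. }
  rewrite rsum_exchange, (rsum_single K i).
  - rewrite rsum_scal, rad_orthogonal by exact Hi. destruct (Nat.eq_dec i i); [|lia].
    field. apply pow_nonzero. lra.
  - exact Hi.
  - intros l Hl Hne. rewrite rsum_scal, rad_orthogonal by assumption.
    destruct (Nat.eq_dec i l); [lia|ring].
Qed.

Lemma rcoef_ext K i y z :
  (forall j, (j < 2 ^ K)%nat -> y j = z j) -> rcoef K i y = rcoef K i z.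
Proof. intros H. unfold rcoef. f_equal. apply rsum_ext. intros j Hj. now rewrite H. Qed.

(* Duality: test [y] against its own Rademacher projection, whose L^q norm is controlled by
   Khintchine's inequality for the conjugate exponent [q = p / (p - 1)]. *)
Lemma khintchine_dual p : 1 < p -> exists A, 0 < A /\ forall K y s, 0 <= s ->
  s ^ 2 = rsum K (fun i => rcoef K i y ^ 2) ->
  2 ^ K * rpow s p <= A * rsum (2 ^ K) (fun j => rpow (Rabs (y j)) p).
Proof.
  intros Hp. set (q := p / (p - 1)).
  assert (Hq : 0 < q) by (apply Rdiv_lt_0_compat; lra).
  destruct (khintchine q Hq) as [A [HA Hk]].
  (* With L^q = 2A, the q-th power term below is exactly half of 2^K and can be absorbed. *)
  set (L := rpow (2 * A) (/ q)).
  assert (HL : 0 < L) by (apply rpow_pos; lra).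
  exists (2 * rpow L p). split; [pose proof (rpow_pos L p HL); lra|].
  intros K y s Hs E.
  set (Y := rsum (2 ^ K) (fun j => rpow (Rabs (y j)) p)).
  assert (HY : 0 <= Y) by (apply rsum_nonneg; intros; apply rpow_nonneg).
  pose proof (rpow_nonneg L p) as HLp.
  destruct Hs as [Hs | <- ]; [|rewrite rpow_0, Rmult_0_r; repeat apply Rmult_le_pos; lra].
  set (z := lin K (fun i => rcoef K i y)).
  assert (H2 : 0 < 2 ^ K) by (apply pow_lt; lra).
  assert (E1 : rsum (2 ^ K) (fun j => y j * z j) = 2 ^ K * s ^ 2).
  { unfold z. rewrite rsum_mul_lin, E. f_equal. apply rsum_ext. intros. ring. }
  assert (Z : rsum (2 ^ K) (fun j => rpow (Rabs (z j)) q) <= A * 2 ^ K * rpow s q)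
    by (apply Hk; lra).
  (* Young's inequality for (L/s) |y| and |z| / (L s), whose product is |y z| / s^2. *)
  assert (Hy : rsum (2 ^ K) (fun j => y j * z j) <=
    s ^ 2 * (rpow (L / s) p * Y + rpow (/ (L * s)) q * (A * 2 ^ K * rpow s q))).
  { apply Rle_trans with (rsum (2 ^ K) (fun j => s ^ 2 *
      (rpow (L / s) p * rpow (Rabs (y j)) p + rpow (/ (L * s)) q * rpow (Rabs (z j)) q))).
    - apply rsum_le. intros j _.
      assert (P1 : 0 < L / s) by (apply Rdiv_lt_0_compat; lra).
      assert (P2 : 0 < / (L * s)) by (apply Rinv_0_lt_compat; nra).
      rewrite <- !rpow_mult by (try apply Rabs_pos; lra).
      apply Rle_trans with (s ^ 2 * ((L / s * Rabs (y j)) * (/ (L * s) * Rabs (z j)))).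
      + replace (s ^ 2 * ((L / s * Rabs (y j)) * (/ (L * s) * Rabs (z j))))
          with (Rabs (y j) * Rabs (z j)) by (field; lra).
        rewrite <- Rabs_mult. apply Rle_abs.
      + apply Rmult_le_compat_l; [nra|].
        apply young_crude; [exact Hp| |]; apply Rmult_le_pos; try apply Rabs_pos; lra.
    - rewrite rsum_scal, rsum_plus, !rsum_scal.
      apply Rmult_le_compat_l; [nra|]. apply Rplus_le_compat_l.
      apply Rmult_le_compat_l; [apply rpow_nonneg|exact Z]. }
  rewrite E1 in Hy.
  assert (Hc : 2 ^ K <= rpow (L / s) p * Y + rpow (/ (L * s)) q * (A * 2 ^ K * rpow s q)).
  { apply Rmult_le_reg_l with (s ^ 2); [nra|]. lra. }
  assert (P : 0 < rpow s p) by now apply rpow_pos.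
  assert (Q1 : rpow (L / s) p * rpow s p = rpow L p).
  { rewrite <- rpow_mult by (try apply Rlt_le, Rdiv_lt_0_compat; lra). f_equal. field. lra. }
  assert (Q2 : rpow (/ (L * s)) q * (A * 2 ^ K * rpow s q) = 2 ^ K / 2).
  { assert (F : rpow (/ (L * s)) q * rpow s q * rpow L q = 1).
    { assert (0 < / (L * s)) by (apply Rinv_0_lt_compat; nra).
      rewrite <- !rpow_mult by (try apply Rmult_le_pos; lra).
      replace (/ (L * s) * s * L) with 1 by (field; lra). apply rpow_1. }
    unfold L in F at 2. rewrite rpow_root in F by lra.
    replace (rpow (/ (L * s)) q * (A * 2 ^ K * rpow s q)) with
      (rpow (/ (L * s)) q * rpow s q * (2 * A) * (2 ^ K / 2)) by field.
    rewrite F. ring. }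
  rewrite Q2 in Hc.
  replace (2 * rpow L p * Y) with (2 * (rpow (L / s) p * Y) * rpow s p) by (rewrite <- Q1; ring).
  apply Rmult_le_compat_r; lra.
Qed.

(** * Dyadic blocks *)

(* Block [K] is the set of the [2^K] indices [bpos K j = 2^K - 1 + j] with [j < 2^K]. *)
Definition blk (n : nat) : nat := Nat.log2 (S n).
Definition off (n : nat) : nat := (S n - 2 ^ blk n)%nat.
Definition bpos (K j : nat) : nat := (2 ^ K - 1 + j)%nat.

Lemma pow2_pos K : (0 < 2 ^ K)%nat.
Proof. apply Nat.neq_0_lt_0, Nat.pow_nonzero. lia. Qed.

Lemma blk_pos K j : (j < 2 ^ K)%nat -> blk (bpos K j) = K.
Proof.
  intros Hj. pose proof (pow2_pos K). unfold blk, bpos. apply Nat.log2_unique; [lia|].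
  rewrite Nat.pow_succ_r'. lia.
Qed.

Lemma off_pos K j : (j < 2 ^ K)%nat -> off (bpos K j) = j.
Proof.
  intros Hj. pose proof (pow2_pos K). unfold off. rewrite blk_pos by exact Hj. unfold bpos. lia.
Qed.

Lemma blk_spec n : (2 ^ blk n <= S n < 2 ^ S (blk n))%nat.
Proof. apply Nat.log2_spec. lia. Qed.

Lemma off_lt n : (off n < 2 ^ blk n)%nat.
Proof. pose proof (blk_spec n) as H. rewrite Nat.pow_succ_r' in H. unfold off. lia. Qed.

Lemma pos_blk_off n : bpos (blk n) (off n) = n.
Proof. pose proof (blk_spec n). pose proof (pow2_pos (blk n)). unfold bpos, off. lia. Qed.

Lemma rsum_blocks K h :
  rsum (2 ^ K - 1) h = rsum K (fun k => rsum (2 ^ k) (fun j => h (bpos k j))).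
Proof.
  induction K as [|K IH]; [reflexivity|].
  pose proof (pow2_pos K).
  replace (2 ^ S K - 1)%nat with (2 ^ K - 1 + 2 ^ K)%nat by (rewrite Nat.pow_succ_r'; lia).
  rewrite rsum_split, IH. reflexivity.
Qed.

(** Energy adds over blocks, so a bound uniform in the block suffices; the first N coordinates lie
    in the first N blocks because N <= 2^N - 1. *)
Lemma lp_le_blocks p x y c B :
  0 <= c ->
  (forall K, rsum (2 ^ K) (fun j => rpow (Cabs (y (bpos K j))) p) <=
             c * rsum (2 ^ K) (fun j => rpow (Cabs (x (bpos K j))) p)) ->
  lp_le p x B -> lp_le p y (c * B).
Proof.
  intros Hc H HB N.
  pose proof (Nat.pow_gt_lin_r 2 N ltac:(lia)) as HN.
  apply Rle_trans with (rsum (2 ^ N - 1) (fun n => rpow (Cabs (y n)) p)).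
  { apply rsum_mono; [lia|]. intros; apply rpow_nonneg. }
  rewrite (rsum_blocks N (fun n => rpow (Cabs (y n)) p)).
  eapply Rle_trans; [apply rsum_le; intros; apply H|].
  rewrite rsum_scal. apply Rmult_le_compat_l; [exact Hc|].
  rewrite <- (rsum_blocks N (fun n => rpow (Cabs (x n)) p)). apply HB.
Qed.

(** * Evaluation points *)

(** The dyadic points of [0,1) listed block by block: block k carries the points l / 2^k. *)
Definition pt (i : nat) : R := INR (off i) / 2 ^ blk i.

Lemma pt_pos k l : (l < 2 ^ k)%nat -> pt (bpos k l) = INR l / 2 ^ k.
Proof. intros. unfold pt. now rewrite blk_pos, off_pos. Qed.

Lemma pt_range i : 0 <= pt i <= 1.
Proof.
  unfold pt. assert (P : 0 < 2 ^ blk i) by (apply pow_lt; lra).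
  pose proof (pos_INR (off i)). pose proof (lt_INR _ _ (off_lt i)) as L.
  rewrite INR_pow2 in L. split.
  - apply Rmult_le_pos; [assumption|]. now apply Rlt_le, Rinv_0_lt_compat.
  - apply Rmult_le_reg_r with (2 ^ blk i); [exact P|].
    unfold Rdiv. rewrite Rmult_assoc, Rinv_l; lra.
Qed.

Lemma pt_dense t e : 0 <= t <= 1 -> 0 < e -> exists i, Rabs (pt i - t) < e.
Proof.
  intros Ht He.
  destruct (pow_lt_1_zero (/ 2) ltac:(rewrite Rabs_pos_eq; lra) e He) as [k Hk].
  specialize (Hk k (le_n k)). rewrite pow_inv in Hk.
  assert (P : 0 < 2 ^ k) by (apply pow_lt; lra).
  rewrite Rabs_pos_eq in Hk by now apply Rlt_le, Rinv_0_lt_compat.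
  (* A floor of 2^k t kept below m = 2^k: the weak inequality on the right lets t = 1 use l = 2^k -
     1. *)
  assert (G : forall m, (0 < m)%nat -> 2 ^ k * t <= INR m ->
    exists l, (l < m)%nat /\ INR l <= 2 ^ k * t <= INR l + 1).
  { induction m as [|m IH]; intros Hm L; [lia|].
    rewrite S_INR in L. destruct (Rle_dec (INR m) (2 ^ k * t)) as [D|D].
    - exists m. split; [lia|lra].
    - destruct m as [|m]; [simpl in D; nra|].
      destruct IH as [l [Hl Hl']]; [lia|lra|]. exists l. split; [lia|exact Hl']. }
  destruct (G (2 ^ k)%nat (pow2_pos k)) as [l [Hl Hb]]; [rewrite INR_pow2; nra|].
  exists (bpos k l). rewrite pt_pos by exact Hl.
  apply Rle_lt_trans with (/ 2 ^ k); [|exact Hk].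
  replace (INR l / 2 ^ k - t) with (/ 2 ^ k * (INR l - 2 ^ k * t)) by (field; lra).
  rewrite Rabs_mult, Rabs_pos_eq by now apply Rlt_le, Rinv_0_lt_compat.
  rewrite <- (Rmult_1_r (/ 2 ^ k)) at 2.
  apply Rmult_le_compat_l; [now apply Rlt_le, Rinv_0_lt_compat|].
  rewrite Rabs_left1; lra.
Qed.

(** Continuity is relative to [0,1]; composing with the 1-Lipschitz clamp [cl] gives a function
    continuous on the whole line, to which the extreme value theorem applies. *)
Lemma in_C01_bounded f : in_C01 f -> exists M, 0 <= M /\ forall t, 0 <= t <= 1 -> Cabs (f t) <= M.
Proof.
  intros Hf. set (cl := fun t => Rmax 0 (Rmin 1 t)).
  assert (Hr : forall t, 0 <= cl t <= 1).
  { intros t. unfold cl, Rmax, Rmin. repeat destruct (Rle_dec _ _); lra. }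
  assert (Hl : forall s t, Rabs (cl s - cl t) <= Rabs (s - t)).
  { intros s t. unfold cl, Rmax, Rmin.
    repeat destruct (Rle_dec _ _); unfold Rabs; repeat destruct (Rcase_abs _); lra. }
  assert (Hc : forall t, 0 <= t <= 1 -> cl t = t).
  { intros t Ht. unfold cl, Rmax, Rmin. repeat destruct (Rle_dec _ _); lra. }
  destruct (continuity_ab_maj (fun t => Cabs (f (cl t))) 0 1) as [m [Hm _]]; [lra| |].
  - intros c Hc01 e He. destruct (Hf (cl c) (Hr c) e He) as [d [Hd Hfd]].
    exists d. split; [exact Hd|]. intros s [_ Hs]. simpl in *. unfold Rdist in *.
    specialize (Hfd (cl s) (Hr s) (Rle_lt_trans _ _ _ (Hl s c) Hs)).
    apply Rle_lt_trans with (2 := Hfd). apply Rabs_le.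
    pose proof (Cabs_triang (Cadd (f (cl s)) (Copp (f (cl c)))) (f (cl c))) as T1.
    pose proof (Cabs_triang (Copp (Cadd (f (cl s)) (Copp (f (cl c))))) (f (cl s))) as T2.
    rewrite Cabs_opp in T2.
    replace (Cadd (Cadd _ _) _) with (f (cl s)) in T1 by ring.
    replace (Cadd (Copp _) _) with (f (cl c)) in T2 by ring. lra.
  - exists (Cabs (f (cl m))). split; [apply Cabs_nonneg|]. intros t Ht.
    specialize (Hm t Ht). simpl in Hm. now rewrite Hc in Hm.
Qed.

Lemma supnorm_ge f r t : supnorm_is f r -> 0 <= t <= 1 -> Cabs (f t) <= r.
Proof. intros [H _] Ht. apply H. now exists t. Qed.

Lemma supnorm_le_of_pt f r d :
  in_C01 f -> supnorm_is f r -> (forall i, Cabs (f (pt i)) <= d) -> r <= d.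
Proof.
  intros Hf [_ Hr] Hd. apply Hr. intros y [t [Ht ->]].
  apply le_epsilon. intros e He.
  destruct (Hf t Ht e He) as [del [Hdel Hcont]].
  destruct (pt_dense t del Ht Hdel) as [i Hi].
  specialize (Hcont (pt i) (pt_range i) Hi). specialize (Hd i).
  pose proof (Cabs_triang (Copp (Cadd (f (pt i)) (Copp (f t)))) (f (pt i))) as T.
  rewrite Cabs_opp in T. replace (Cadd (Copp _) _) with (f t) in T by ring. lra.
Qed.

(** * A criterion for trivial extensions *)

(** The hypothesis on [v] says that its energy is at least 1; scaling multiplies energy by |a|^p. *)
Lemma lp_le_vscal_unit p a v B :
  (forall D, lp_le p v D -> 1 <= D) -> lp_le p (vscal a v) B -> rpow (Cabs a) p <= B.
Proof.
  intros Hv H. pose proof (lp_le_nonneg _ _ _ H) as HB.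
  destruct (rpow_nonneg (Cabs a) p) as [P|P]; [|lra].
  assert (L : 1 <= B / rpow (Cabs a) p).
  { apply Hv. intros N. apply Rmult_le_reg_l with (rpow (Cabs a) p); [exact P|].
    replace (rpow (Cabs a) p * (B / rpow (Cabs a) p)) with B by (field; lra).
    rewrite <- rsum_scal. eapply Rle_trans; [|apply (H N)]. right. apply rsum_ext. intros.
    unfold vscal. now rewrite Cabs_mul, rpow_mult by apply Cabs_nonneg. }
  apply Rmult_le_compat_l with (r := rpow (Cabs a) p) in L; [|lra].
  replace (rpow (Cabs a) p * (B / rpow (Cabs a) p)) with B in L by (field; lra). lra.
Qed.

(** On the eigenvectors [T + K] acts as [mu] up to [K (v k)], which tends to 0, so no compact
    perturbation hides the eigenvalue. The factor 1/2 is the price of the quasi-triangle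
    inequality. *)
Lemma calkin_norm_ge_eigen p T v (mu : C) r :
  1 < p -> bounded_op p T -> disjoint_seq v -> (forall k, lp_le p (v k) 1) ->
  (forall k B, lp_le p (v k) B -> 1 <= B) -> (forall k, T (v k) = vscal mu (v k)) ->
  r <= Cabs mu -> calkin_norm_ge p T (/ 2 * r).
Proof.
  intros Hp HT Hd H1 Hu He Hr K d HK Hn. assert (Hp0 : 0 < p) by lra.
  assert (Hin : forall x, in_lp p x -> in_lp p (opadd T K x)).
  { intros x Hx. destruct HT as [HT _], HK as [[HK _] _].
    destruct (in_lp_lp_le _ _ (HT x Hx)) as [A HA], (in_lp_lp_le _ _ (HK x Hx)) as [B HB].
    eapply lp_le_in_lp, lp_le_vadd; eassumption. }
  (* A nonzero vector forces d >= 0, so that [Rmax d 0] below is [d]. *)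
  assert (Hd0 : 0 <= d).
  { pose proof (lp_le_in_lp _ _ _ (H1 O)) as I.
    destruct (in_lp_norm p _ Hp0 I) as [a Ha], (in_lp_norm p _ Hp0 (Hin _ I)) as [b Hb].
    pose proof (Hn _ _ _ Ha Hb) as L. pose proof (Hu O _ (lp_le_norm _ _ _ Ha)) as La.
    destruct Ha as [Ha _], Hb as [Hb _].
    destruct Ha as [Ha | <- ]; [|rewrite rpow_0 in La; lra].
    destruct (Rle_dec 0 d); [assumption|nra]. }
  pose proof (energy_of_opnorm_le p _ d Hp0 Hin Hn) as [_ HE].
  rewrite Rmax_left in HE by exact Hd0.
  assert (L : Cabs mu <= 2 * d).
  { apply rpow_le_inv with p; [exact Hp0|lra|]. rewrite rpow_mult by lra.
    apply le_epsilon. intros e He0.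
    pose proof (rpow_2_ge1 p Hp0) as P2.
    destruct (compact_disjoint_null p K v 1 Hp HK Hd H1 (e / rpow 2 p)) as [k Hk];
      [apply Rdiv_lt_0_compat; lra|].
    specialize (Hk k (le_n k)).
    apply (lp_le_vscal_unit p mu (v k)); [apply Hu|]. rewrite <- He.
    replace (T (v k)) with (vsub (opadd T K (v k)) (K (v k)))
      by (extensionality n; unfold vsub, opadd, vadd; ring).
    eapply lp_le_weaken; [apply lp_le_vsub; [exact Hp0|apply HE, H1|exact Hk]|].
    right. field. lra. }
  lra.
Qed.

Lemma opadd_vzero T : opadd T (fun _ => vzero) = T.
Proof. extensionality x. extensionality n. unfold opadd, vadd, vzero. ring. Qed.

Lemma compact_op_vzero p : 0 < p -> compact_op p (fun _ => vzero).
Proof. intros. apply compact_op_zero; [assumption|]. intros x _. reflexivity. Qed.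

(** [rho] serves both as lift and as homomorphism, the algebraic identities being exact. Each
    [f (pt i)] is an eigenvalue with infinitely many disjoint unit eigenvectors, hence bounds the
    quotient norm from below; density of the points brings in the sup norm. *)
Lemma trivial_ext_of_eigenvectors p (rho : cfun -> op) A :
  1 < p -> 0 < A ->
  (forall f M, 0 <= M -> (forall i, Cabs (f (pt i)) <= M) ->
     energy_bound p (rho f) (rpow (A * M) p)) ->
  (forall f, linear_op p (rho f)) ->
  (forall a b f g x, rho (fadd (fscal a f) (fscal b g)) x =
     vadd (vscal a (rho f x)) (vscal b (rho g x))) ->
  (forall f g x, rho (fmul f g) x = rho f (rho g x)) ->
  (forall x, rho fone x = x) ->
  (forall i, exists v, disjoint_seq v /\ forall k,
     lp_le p (v k) 1 /\ (forall B, lp_le p (v k) B -> 1 <= B) /\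
     forall f, rho f (v k) = vscal (f (pt i)) (v k)) ->
  trivial_ext p rho.
Proof.
  intros Hp HA HE HL Hadd Hmul Hone Heig. assert (Hp0 : 0 < p) by lra.
  assert (Hz : forall T U, (forall x, T x = U x) -> compact_op p (opsub T U)).
  { intros T U H. apply compact_op_zero; [exact Hp0|]. intros x _.
    extensionality n. unfold opsub, vsub, vzero. rewrite H. ring. }
  assert (Hb : forall f, in_C01 f -> bounded_op p (rho f)).
  { intros f Hf. destruct (in_C01_bounded f Hf) as [M [HM HfM]].
    eapply bounded_op_energy; [exact Hp0|apply HL|].
    apply (HE f M HM). intros i. apply HfM, pt_range. }
  assert (Hge : forall f r, in_C01 f -> supnorm_is f r -> calkin_norm_ge p (rho f) (/ 2 * r)).
  { intros f r Hf Hr K d HK Hd.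
    assert (r <= 2 * d); [|lra].
    apply (supnorm_le_of_pt f); try assumption. intros i.
    destruct (Heig i) as [v [Hdis Hv]].
    assert (L : / 2 * Cabs (f (pt i)) <= d); [|lra].
    refine (calkin_norm_ge_eigen p (rho f) v (f (pt i)) _ Hp (Hb f Hf) Hdis _ _ _
      (Rle_refl _) K d HK Hd); intros k; destruct (Hv k) as [V1 [V2 V3]]; auto. }
  assert (Hle : forall f r, in_C01 f -> supnorm_is f r -> opnorm_le p (rho f) (A * r)).
  { intros f r Hf Hr.
    assert (Hfr : forall i, Cabs (f (pt i)) <= r)
      by (intros; apply supnorm_ge; auto using pt_range).
    assert (Hr0 : 0 <= r) by (eapply Rle_trans; [apply Cabs_nonneg|apply (Hfr O)]).
    apply opnorm_le_energy; [exact Hp0| |now apply HE]. apply Rmult_le_pos; lra. }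
  split; [split; [|split; [|split; [|split]]]|].
  - exact Hb.
  - intros. apply Hz. intros. apply Hadd.
  - intros. apply Hz. intros. apply Hmul.
  - apply Hz. exact Hone.
  - exists (/ 2), A. split; [lra|]. split; [exact HA|]. intros f r Hf Hr.
    split; [now apply Hge|]. intros e He. exists (fun _ => vzero).
    split; [now apply compact_op_vzero|]. rewrite opadd_vzero.
    intros x a b Ha Hb'. pose proof (Hle f r Hf Hr x a b Ha Hb'). destruct Ha as [Ha _]. nra.
  - exists rho. split; [exact Hb|]. split; [|split; [|split; [|split]]].
    + intros a b f g _ _ x _. apply Hadd.
    + intros f g _ _ x _. apply Hmul.
    + intros x _. apply Hone.
    + exists (/ 2), A. split; [lra|]. split; [exact HA|]. intros f r Hf Hr.
      (* The lower bound for the operator norm is the Calkin bound with perturbation 0. *)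
      split; [|now apply Hle]. intros d Hd. apply (Hge f r Hf Hr (fun _ => vzero));
        [now apply compact_op_vzero|]. now rewrite opadd_vzero.
    + intros. now apply Hz.
Qed.

(** * The diagonal extension *)

(** [off] takes the value i once in every block of size above i, so each [pt i] occurs infinitely
    often on the diagonal. *)
Definition rho_diag (f : cfun) : op := fun x n => Cmul (f (pt (off n))) (x n).

Definition unit_vec (m : nat) : seqC := fun n => if Nat.eq_dec n m then C1 else C0.

Lemma lp_le_unit_vec p m : lp_le p (unit_vec m) 1.
Proof.
  intros N. destruct (Nat.lt_ge_cases m N) as [L|L].
  - rewrite (rsum_single N m); [|exact L|].
    + unfold unit_vec. destruct (Nat.eq_dec m m); [|lia]. rewrite Cabs_C1, rpow_1. lra.
    + intros j _ Hj. unfold unit_vec. destruct (Nat.eq_dec j m); [lia|].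
      now rewrite Cabs_C0, rpow_0.
  - rewrite rsum_0; [lra|]. intros j Hj. unfold unit_vec. destruct (Nat.eq_dec j m); [lia|].
    now rewrite Cabs_C0, rpow_0.
Qed.

Lemma unit_vec_energy p m B : lp_le p (unit_vec m) B -> 1 <= B.
Proof.
  intros H. apply (lp_le_coord p _ _ m) in H. unfold unit_vec in H.
  destruct (Nat.eq_dec m m); [|lia]. now rewrite Cabs_C1, rpow_1 in H.
Qed.

Lemma trivial_ext_diag p : 1 < p -> trivial_ext p rho_diag.
Proof.
  intros Hp. apply (trivial_ext_of_eigenvectors p rho_diag 1); try lra.
  - intros f M HM Hf. split; [apply rpow_nonneg|]. intros x B.
    apply lp_le_pointwise; [apply rpow_nonneg|]. intros n. unfold rho_diag.
    rewrite Rmult_1_l, Cabs_mul, rpow_mult by apply Cabs_nonneg.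
    apply Rmult_le_compat_r; [apply rpow_nonneg|].
    apply rpow_le; [lra|apply Cabs_nonneg|apply Hf].
  - intros f a b x y _ _. extensionality n. unfold rho_diag, vadd, vscal. ring.
  - intros. extensionality n. unfold rho_diag, vadd, vscal, fadd, fscal. ring.
  - intros. extensionality n. unfold rho_diag, fmul. ring.
  - intros. extensionality n. unfold rho_diag, fone. ring.
  (* Position i exists in block k + i because i < 2^(k+i), and distinct k give distinct blocks. *)
  - intros i. exists (fun k => unit_vec (bpos (k + i) i)).
    assert (Hi : forall k, (i < 2 ^ (k + i))%nat).
    { intros k. pose proof (Nat.pow_gt_lin_r 2 (k + i) ltac:(lia)). lia. }
    split; [|intros k; split; [apply lp_le_unit_vec|split; [apply unit_vec_energy|]]].
    + intros j k n Hjk. unfold unit_vec.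
      destruct (Nat.eq_dec n (bpos (j + i) i)) as [E1|]; [|now left].
      destruct (Nat.eq_dec n (bpos (k + i) i)) as [E2|]; [|now right].
      rewrite E1 in E2. apply (f_equal blk) in E2. rewrite !blk_pos in E2 by apply Hi. lia.
    + intros f. extensionality n. unfold rho_diag, vscal, unit_vec.
      destruct (Nat.eq_dec n (bpos (k + i) i)) as [ -> |]; [|ring].
      now rewrite off_pos by apply Hi.
Qed.

(** * The Rademacher extension *)

(** The complex form of [lin], as [coef] is that of [rcoef]. The signs are real, so real and
    imaginary parts reduce to the real estimates. *)
Definition walsh (K : nat) (a : nat -> C) (j : nat) : C :=
  csum K (fun i => Cmul (a i) (RtoC (rad i j))).

Definition coef (K i : nat) (x : seqC) : C :=
  Cmul (RtoC (/ 2 ^ K)) (csum (2 ^ K) (fun j => Cmul (RtoC (rad i j)) (x (bpos K j)))).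

(** A multiplier on each block; [d = 1] would give the Rademacher projection. *)
Definition rad_mult (d : nat -> C) : op :=
  fun x n => walsh (blk n) (fun i => Cmul (d i) (coef (blk n) i x)) (off n).

(* On block [K] this is [f (pt i)] on the [i]-th Rademacher function for [i < K], and
   [f (pt 0)] on the orthogonal complement of these functions. *)
Definition rho_rad (f : cfun) : op := fun x =>
  vadd (vscal (f (pt 0)) x) (rad_mult (fun i => Cadd (f (pt i)) (Copp (f (pt 0)))) x).

Lemma rho_rad_apply f x n :
  rho_rad f x n = Cadd (Cmul (f (pt 0)) (x n))
    (walsh (blk n) (fun i => Cmul (Cadd (f (pt i)) (Copp (f (pt 0)))) (coef (blk n) i x)) (off n)).
Proof. reflexivity. Qed.

(** * Algebraic identities of the Rademacher extension *)

Lemma walsh_ext K a b j : (forall i, (i < K)%nat -> a i = b i) -> walsh K a j = walsh K b j.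
Proof. intros H. apply csum_ext. intros i Hi. now rewrite H. Qed.

Lemma walsh_lin K s t a b j :
  walsh K (fun i => Cadd (Cmul s (a i)) (Cmul t (b i))) j =
  Cadd (Cmul s (walsh K a j)) (Cmul t (walsh K b j)).
Proof.
  unfold walsh. rewrite <- !csum_scal, <- csum_add. apply csum_ext. intros. ring.
Qed.

Lemma coef_lin K i a b x y :
  coef K i (vadd (vscal a x) (vscal b y)) = Cadd (Cmul a (coef K i x)) (Cmul b (coef K i y)).
Proof.
  unfold coef, vadd, vscal.
  rewrite (csum_ext _ _ (fun j => Cadd (Cmul a (Cmul (RtoC (rad i j)) (x (bpos K j))))
                                       (Cmul b (Cmul (RtoC (rad i j)) (y (bpos K j))))))
    by (intros; ring).
  rewrite csum_add, !csum_scal. ring.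
Qed.

Lemma fst_walsh K a j : fst (walsh K a j) = lin K (fun i => fst (a i)) j.
Proof. unfold walsh. rewrite fst_csum. apply rsum_ext. intros. simpl. ring. Qed.

Lemma snd_walsh K a j : snd (walsh K a j) = lin K (fun i => snd (a i)) j.
Proof. unfold walsh. rewrite snd_csum. apply rsum_ext. intros. simpl. ring. Qed.

Lemma fst_coef K i x : fst (coef K i x) = rcoef K i (fun j => fst (x (bpos K j))).
Proof.
  unfold coef, rcoef. simpl. rewrite fst_csum, Rmult_0_l, Rminus_0_r. f_equal.
  apply rsum_ext. intros. simpl. ring.
Qed.

Lemma snd_coef K i x : snd (coef K i x) = rcoef K i (fun j => snd (x (bpos K j))).
Proof.
  unfold coef, rcoef. simpl. rewrite snd_csum, Rmult_0_l, Rplus_0_r. f_equal.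
  apply rsum_ext. intros. simpl. ring.
Qed.

Lemma coef_walsh K i x a :
  (i < K)%nat -> (forall j, (j < 2 ^ K)%nat -> x (bpos K j) = walsh K a j) -> coef K i x = a i.
Proof.
  intros Hi H. apply injective_projections.
  - rewrite fst_coef, (rcoef_ext _ _ _ (lin K (fun i => fst (a i)))).
    + now rewrite rcoef_lin.
    + intros j Hj. now rewrite H, fst_walsh.
  - rewrite snd_coef, (rcoef_ext _ _ _ (lin K (fun i => snd (a i)))).
    + now rewrite rcoef_lin.
    + intros j Hj. now rewrite H, snd_walsh.
Qed.

(** The scalar part contributes f(pt 0) and the multiplier f(pt i) - f(pt 0). Multiplicativity of
    [rho_rad] rests on this. *)
Lemma coef_rho_rad K i f x : (i < K)%nat -> coef K i (rho_rad f x) = Cmul (f (pt i)) (coef K i x).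
Proof.
  intros Hi. unfold rho_rad. rewrite <- (vscal_C1 (rad_mult _ x)), coef_lin.
  rewrite (coef_walsh K i (rad_mult _ x)
    (fun i => Cmul (Cadd (f (pt i)) (Copp (f (pt 0)))) (coef K i x)) Hi).
  - ring.
  - intros j Hj. unfold rad_mult. now rewrite blk_pos, off_pos.
Qed.

Lemma rho_rad_linear p f : linear_op p (rho_rad f).
Proof.
  intros a b x y _ _. extensionality n. rewrite rho_rad_apply.
  rewrite (walsh_ext _ _ (fun i =>
    Cadd (Cmul a (Cmul (Cadd (f (pt i)) (Copp (f (pt 0)))) (coef (blk n) i x)))
         (Cmul b (Cmul (Cadd (f (pt i)) (Copp (f (pt 0)))) (coef (blk n) i y)))))
    by (intros; rewrite coef_lin; ring).
  rewrite walsh_lin. unfold vadd, vscal. rewrite !rho_rad_apply. ring.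
Qed.

Lemma rho_rad_add a b f g x :
  rho_rad (fadd (fscal a f) (fscal b g)) x = vadd (vscal a (rho_rad f x)) (vscal b (rho_rad g x)).
Proof.
  extensionality n. unfold rho_rad, rad_mult, vadd, vscal, fadd, fscal.
  rewrite (walsh_ext _ _ (fun i =>
    Cadd (Cmul a (Cmul (Cadd (f (pt i)) (Copp (f (pt 0)))) (coef (blk n) i x)))
         (Cmul b (Cmul (Cadd (g (pt i)) (Copp (g (pt 0)))) (coef (blk n) i x)))))
    by (intros; ring).
  rewrite walsh_lin. ring.
Qed.

Lemma rho_rad_mul f g x : rho_rad (fmul f g) x = rho_rad f (rho_rad g x).
Proof.
  extensionality n. rewrite (rho_rad_apply (fmul f g)), (rho_rad_apply f). unfold fmul.
  rewrite (walsh_ext (blk n) (fun i => Cmul _ (coef (blk n) i (rho_rad g x)))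
    (fun i => Cmul (Cadd (f (pt i)) (Copp (f (pt 0)))) (Cmul (g (pt i)) (coef (blk n) i x))))
    by (intros; now rewrite coef_rho_rad).
  rewrite rho_rad_apply.
  (* The splitting behind the last step is f_i g_i - f_0 g_0 = f_0 (g_i - g_0) + (f_i - f_0) g_i,
     indices standing for the points. *)
  rewrite (walsh_ext _ _ (fun i =>
    Cadd (Cmul (f (pt 0)) (Cmul (Cadd (g (pt i)) (Copp (g (pt 0)))) (coef (blk n) i x)))
         (Cmul C1 (Cmul (Cadd (f (pt i)) (Copp (f (pt 0)))) (Cmul (g (pt i)) (coef (blk n) i x))))))
    by (intros; ring).
  rewrite walsh_lin. ring.
Qed.

Lemma rho_rad_one x : rho_rad fone x = x.
Proof.
  extensionality n. unfold rho_rad, rad_mult, vadd, vscal, fone, walsh.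
  rewrite csum_0; [ring|]. intros. ring.
Qed.

(** On each block [khintchine_dual] bounds the l^2 norm of the coefficients by the energy, the
    multiplier costs a factor M, and [khintchine] returns to l^p. The factors 2^K match, so the
    constant is uniform over blocks. *)
Lemma rad_mult_energy p : 1 < p -> exists A, 0 < A /\ forall d M, 0 <= M ->
  (forall i, Cabs (d i) <= M) -> energy_bound p (rad_mult d) (A * rpow M p).
Proof.
  intros Hp. assert (Hp0 : 0 < p) by lra.
  destruct (khintchine p Hp0) as [A1 [HA1 H1]].
  destruct (khintchine_dual p Hp) as [A2 [HA2 H2]].
  pose proof (rpow_2_ge1 p Hp0) as P2.
  exists (rpow 2 p * (2 * (A1 * (rpow 2 p * (2 * A2))))). split.
  { repeat apply Rmult_lt_0_compat; lra. }
  intros d M HM Hd. split.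
  { repeat apply Rmult_le_pos; try apply rpow_nonneg; lra. }
  intros x B. apply lp_le_blocks.
  { repeat apply Rmult_le_pos; try apply rpow_nonneg; lra. }
  intros K. set (X := rsum (2 ^ K) (fun j => rpow (Cabs (x (bpos K j))) p)).
  set (y1 := fun j => fst (x (bpos K j))). set (y2 := fun j => snd (x (bpos K j))).
  set (q1 := rsum K (fun i => rcoef K i y1 ^ 2)). set (q2 := rsum K (fun i => rcoef K i y2 ^ 2)).
  assert (Hq1 : 0 <= q1) by (apply rsum_nonneg; intros; apply pow2_ge_0).
  assert (Hq2 : 0 <= q2) by (apply rsum_nonneg; intros; apply pow2_ge_0).
  set (s1 := sqrt q1). set (s2 := sqrt q2).
  assert (Hs1 : s1 ^ 2 = q1) by now apply pow2_sqrt.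
  assert (Hs2 : s2 ^ 2 = q2) by now apply pow2_sqrt.
  assert (Ps1 : 0 <= s1) by apply sqrt_pos. assert (Ps2 : 0 <= s2) by apply sqrt_pos.
  assert (Y : forall y : nat -> R, (forall j, Rabs (y j) <= Cabs (x (bpos K j))) ->
    rsum (2 ^ K) (fun j => rpow (Rabs (y j)) p) <= X).
  { intros y Hy. apply rsum_le. intros. apply rpow_le; auto using Rabs_pos. }
  pose proof (H2 K y1 s1 Ps1 Hs1) as B1. pose proof (H2 K y2 s2 Ps2 Hs2) as B2.
  pose proof (Y y1 (fun j => Rabs_fst_le _)) as Y1.
  pose proof (Y y2 (fun j => Rabs_snd_le _)) as Y2.
  assert (HS : 2 ^ K * rpow (s1 + s2) p <= rpow 2 p * (2 * A2) * X).
  { pose proof (rpow_add_le s1 s2 p Hp0 Ps1 Ps2) as L.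
    assert (P : 0 < 2 ^ K) by (apply pow_lt; lra).
    apply Rle_trans with (2 ^ K * (rpow 2 p * (rpow s1 p + rpow s2 p)));
      [apply Rmult_le_compat_l; lra|].
    replace (2 ^ K * (rpow 2 p * (rpow s1 p + rpow s2 p))) with
      (rpow 2 p * (2 ^ K * rpow s1 p + 2 ^ K * rpow s2 p)) by ring.
    rewrite Rmult_assoc. apply Rmult_le_compat_l; [lra|].
    apply Rmult_le_compat_l with (r := A2) in Y1, Y2; lra. }
  set (a := fun i => Cmul (d i) (coef K i x)).
  assert (Ha : rsum K (fun i => Cabs (a i) ^ 2) <= (M * (s1 + s2)) ^ 2).
  { apply Rle_trans with
      (rsum K (fun i => M ^ 2 * (rcoef K i y1 ^ 2 + rcoef K i y2 ^ 2))).
    - apply rsum_le. intros i _. unfold a. rewrite Cabs_mul, Rpow_mult_distr.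
      replace (rcoef K i y1 ^ 2 + rcoef K i y2 ^ 2) with (Cabs (coef K i x) ^ 2).
      + apply Rmult_le_compat_r; [apply pow2_ge_0|]. apply pow_incr.
        split; [apply Cabs_nonneg|apply Hd].
      + simpl. rewrite Rmult_1_r, Cabs_sqr, fst_coef, snd_coef. reflexivity.
    - rewrite rsum_scal, rsum_plus. fold q1 q2. rewrite <- Hs1, <- Hs2, Rpow_mult_distr.
      apply Rmult_le_compat_l; [apply pow2_ge_0|]. nra. }
  assert (HMs : 0 <= M * (s1 + s2)) by (apply Rmult_le_pos; lra).
  assert (Hlin : forall c : nat -> R, (forall i, Rabs (c i) <= Cabs (a i)) ->
    rsum (2 ^ K) (fun j => rpow (Rabs (lin K c j)) p) <= A1 * 2 ^ K * rpow (M * (s1 + s2)) p).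
  { intros c Hc. apply H1; [exact HMs|]. eapply Rle_trans; [|exact Ha]. apply rsum_le.
    intros i _. rewrite <- (pow2_abs (c i)). apply pow_incr. split; [apply Rabs_pos|apply Hc]. }
  apply Rle_trans with (rsum (2 ^ K) (fun j => rpow 2 p *
    (rpow (Rabs (lin K (fun i => fst (a i)) j)) p + rpow (Rabs (lin K (fun i => snd (a i)) j)) p))).
  - apply rsum_le. intros j Hj. unfold rad_mult. rewrite blk_pos, off_pos by exact Hj. fold a.
    eapply Rle_trans; [apply rpow_le; [exact Hp0|apply Cabs_nonneg|apply Cabs_le_components]|].
    rewrite fst_walsh, snd_walsh. apply rpow_add_le; auto using Rabs_pos.
  - rewrite rsum_scal, rsum_plus.
    pose proof (Hlin (fun i => fst (a i)) (fun i => Rabs_fst_le _)).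
    pose proof (Hlin (fun i => snd (a i)) (fun i => Rabs_snd_le _)).
    apply Rle_trans with (rpow 2 p * (2 * (A1 * 2 ^ K * rpow (M * (s1 + s2)) p)));
      [apply Rmult_le_compat_l; lra|].
    rewrite rpow_mult by lra.
    replace (rpow 2 p * (2 * (A1 * 2 ^ K * (rpow M p * rpow (s1 + s2) p)))) with
      (rpow 2 p * 2 * A1 * rpow M p * (2 ^ K * rpow (s1 + s2) p)) by ring.
    replace (rpow 2 p * (2 * (A1 * (rpow 2 p * (2 * A2)))) * rpow M p * X) with
      (rpow 2 p * 2 * A1 * rpow M p * (rpow 2 p * (2 * A2) * X)) by ring.
    apply Rmult_le_compat_l; [|exact HS].
    pose proof (rpow_nonneg M p). repeat apply Rmult_le_pos; lra.
Qed.

Lemma rho_rad_energy p : 1 < p -> exists A, 0 < A /\ forall f M, 0 <= M ->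
  (forall i, Cabs (f (pt i)) <= M) -> energy_bound p (rho_rad f) (rpow (A * M) p).
Proof.
  intros Hp. assert (Hp0 : 0 < p) by lra.
  destruct (rad_mult_energy p Hp) as [A [HA H]].
  pose proof (rpow_2_ge1 p Hp0) as P2.
  (* One 2^p comes from adding the two parts, the other from the bound 2M on f(pt i) - f(pt 0). *)
  set (D := rpow 2 p * (1 + A * rpow 2 p)).
  assert (HD : 0 < D) by (apply Rmult_lt_0_compat; nra).
  exists (rpow D (/ p)). split; [now apply rpow_pos|].
  intros f M HM Hf. rewrite rpow_mult, rpow_root by (try apply rpow_nonneg; lra).
  pose proof (rpow_nonneg M p) as PM.
  split; [apply Rmult_le_pos; lra|]. intros x B HB.
  pose proof (lp_le_nonneg _ _ _ HB) as B0.
  assert (L1 : lp_le p (vscal (f (pt 0)) x) (rpow M p * B)).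
  { eapply lp_le_weaken; [apply lp_le_vscal; exact HB|]. apply Rmult_le_compat_r; [exact B0|].
    apply rpow_le; auto using Cabs_nonneg. }
  destruct (H (fun i => Cadd (f (pt i)) (Copp (f (pt 0)))) (2 * M)) as [_ L2]; [lra| |].
  { intros i. eapply Rle_trans; [apply Cabs_triang|]. rewrite Cabs_opp.
    pose proof (Hf i). pose proof (Hf O). lra. }
  specialize (L2 x B HB).
  eapply lp_le_weaken; [apply lp_le_vadd; eassumption|].
  rewrite rpow_mult by lra. unfold D. right. ring.
Qed.

Definition block_vec (K : nat) (a : nat -> C) : seqC :=
  fun n => if Nat.eq_dec (blk n) K then walsh K a (off n) else C0.

(** By orthogonality the coefficients on block K are the [a i], and those on other blocks vanish. *)
Lemma rho_rad_block_vec f K a :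
  rho_rad f (block_vec K a) = block_vec K (fun i => Cmul (f (pt i)) (a i)).
Proof.
  extensionality n. rewrite rho_rad_apply. unfold block_vec at 1 3.
  destruct (Nat.eq_dec (blk n) K) as [E|E].
  - rewrite E.
    rewrite (walsh_ext K (fun i => Cmul _ (coef K i _))
      (fun i => Cmul (Cadd (f (pt i)) (Copp (f (pt 0)))) (a i))).
    + rewrite (walsh_ext K (fun i => Cmul (f (pt i)) (a i)) (fun i => Cadd (Cmul (f (pt 0)) (a i))
        (Cmul C1 (Cmul (Cadd (f (pt i)) (Copp (f (pt 0)))) (a i))))) by (intros; ring).
      rewrite walsh_lin. ring.
    + intros i Hi. rewrite (coef_walsh K i _ a Hi); [reflexivity|].
      intros j Hj. unfold block_vec. rewrite blk_pos, off_pos by exact Hj.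
      destruct (Nat.eq_dec K K); [reflexivity|lia].
  - unfold walsh. rewrite csum_0; [ring|]. intros i Hi.
    unfold coef. rewrite csum_0; [ring|]. intros j Hj.
    unfold block_vec. rewrite blk_pos by exact Hj. destruct (Nat.eq_dec (blk n) K); [lia|ring].
Qed.

Lemma block_vec_disjoint (K : nat -> nat) (a : nat -> nat -> C) :
  (forall j k, j <> k -> K j <> K k) -> disjoint_seq (fun k => block_vec (K k) (a k)).
Proof.
  intros H j k n Hjk. unfold block_vec. specialize (H j k Hjk).
  destruct (Nat.eq_dec (blk n) (K j)); [|now left].
  destruct (Nat.eq_dec (blk n) (K k)); [lia|now right].
Qed.

(* The factor [2^(-K/p)] normalises the l^p norm of a Rademacher function on block [K] to 1. *)
Definition rad_vec (p : R) (K : nat) (a : nat -> R) : seqC :=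
  block_vec K (fun i => RtoC (rpow (2 ^ K) (- / p) * a i)).

Lemma rho_rad_rad_vec p f K a b :
  (forall i, (i < K)%nat -> Cmul (f (pt i)) (RtoC (a i)) = RtoC (b i)) ->
  rho_rad f (rad_vec p K a) = rad_vec p K b.
Proof.
  intros H. unfold rad_vec. rewrite rho_rad_block_vec. extensionality n. unfold block_vec.
  destruct (Nat.eq_dec (blk n) K); [|reflexivity]. apply walsh_ext. intros i Hi.
  rewrite !RtoC_mul, <- H by exact Hi. ring.
Qed.

(** The normalising factor contributes 2^(-K), so the energy is the mean of |lin|^p over the cube.
    The equivalence serves upper and lower bounds alike. *)
Lemma rad_vec_energy p K a B : 0 < p ->
  lp_le p (rad_vec p K a) B <-> rsum (2 ^ K) (fun j => rpow (Rabs (lin K a j)) p) <= B * 2 ^ K.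
Proof.
  intros Hp. set (h := fun n => rpow (Cabs (rad_vec p K a n)) p).
  assert (P : 0 < 2 ^ K) by (apply pow_lt; lra).
  assert (Pi : 0 < / 2 ^ K) by now apply Rinv_0_lt_compat.
  assert (Hl : rpow (rpow (2 ^ K) (- / p)) p = / 2 ^ K).
  { rewrite rpow_rpow. replace (- / p * p) with (- (1)) by (field; lra).
    rewrite rpow_Rpower, Rpower_Ropp, Rpower_1; auto. }
  assert (HK : rsum (2 ^ K) (fun j => h (bpos K j)) =
               / 2 ^ K * rsum (2 ^ K) (fun j => rpow (Rabs (lin K a j)) p)).
  { rewrite <- rsum_scal. apply rsum_ext. intros j Hj. unfold h, rad_vec, block_vec.
    rewrite blk_pos, off_pos by exact Hj. destruct (Nat.eq_dec K K); [|lia].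
    unfold walsh. rewrite (csum_ext _ _
      (fun i => RtoC (rpow (2 ^ K) (- / p) * (a i * rad i j)))).
    - rewrite csum_RtoC, Cabs_RtoC, rsum_scal. fold (lin K a j).
      rewrite Rabs_mult, Rabs_pos_eq by apply rpow_nonneg.
      rewrite rpow_mult, Hl by auto using rpow_nonneg, Rabs_pos. reflexivity.
    - intros. rewrite <- RtoC_mul. f_equal. ring. }
  assert (H0 : forall k, k <> K -> rsum (2 ^ k) (fun j => h (bpos k j)) = 0).
  { intros k Hk. apply rsum_0. intros j Hj. unfold h, rad_vec, block_vec.
    rewrite blk_pos by exact Hj. destruct (Nat.eq_dec k K); [lia|]. now rewrite Cabs_C0, rpow_0. }
  assert (HN : forall N, (K < N)%nat -> rsum (2 ^ N - 1) h = rsum (2 ^ K) (fun j => h (bpos K j))).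
  { intros N Hn. rewrite rsum_blocks.
    apply (rsum_single N K (fun k => rsum (2 ^ k) (fun j => h (bpos k j))) Hn).
    intros k _ Hk. now apply H0. }
  assert (E : rsum (2 ^ K) (fun j => h (bpos K j)) <= B <->
              rsum (2 ^ K) (fun j => rpow (Rabs (lin K a j)) p) <= B * 2 ^ K).
  { rewrite HK. split; intros L.
    - apply Rmult_le_compat_r with (r := 2 ^ K) in L; [|lra].
      replace (/ 2 ^ K * rsum (2 ^ K) (fun j => rpow (Rabs (lin K a j)) p) * 2 ^ K) with
        (rsum (2 ^ K) (fun j => rpow (Rabs (lin K a j)) p)) in L by (field; lra). exact L.
    - apply Rmult_le_reg_r with (2 ^ K); [exact P|].
      replace (/ 2 ^ K * rsum (2 ^ K) (fun j => rpow (Rabs (lin K a j)) p) * 2 ^ K) with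
        (rsum (2 ^ K) (fun j => rpow (Rabs (lin K a j)) p)) by (field; lra). exact L. }
  rewrite <- E. split.
  - intros H. rewrite <- (HN (S K)) by lia. apply H.
  - intros H N. fold h.
    (* Enlarge the partial sum until it covers block K. *)
    apply Rle_trans with (rsum (2 ^ (S (K + N)) - 1) h).
    + apply rsum_mono; [|intros; apply rpow_nonneg].
      pose proof (Nat.pow_gt_lin_r 2 (S (K + N)) ltac:(lia)). lia.
    + rewrite HN by lia. exact H.
Qed.

Definition kron (i : nat) : nat -> R := fun j => if Nat.eq_dec j i then 1 else 0.

Lemma rad_vec_kron_energy p K i B :
  0 < p -> (i < K)%nat -> lp_le p (rad_vec p K (kron i)) B <-> 1 <= B.
Proof.
  intros Hp Hi. rewrite rad_vec_energy by exact Hp.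
  assert (P : 0 < 2 ^ K) by (apply pow_lt; lra).
  rewrite (rsum_ext _ _ (fun _ => 1)).
  - rewrite rsum_const, INR_pow2. split; nra.
  - intros j _. unfold lin. rewrite (rsum_single K i); [|exact Hi|].
    + unfold kron. destruct (Nat.eq_dec i i); [|lia]. now rewrite Rmult_1_l, Rabs_rad, rpow_1.
    + intros l _ Hl. unfold kron. destruct (Nat.eq_dec l i); [lia|ring].
Qed.

Lemma trivial_ext_rad p : 1 < p -> trivial_ext p rho_rad.
Proof.
  intros Hp. assert (Hp0 : 0 < p) by lra.
  destruct (rho_rad_energy p Hp) as [A [HA HE]].
  apply (trivial_ext_of_eigenvectors p rho_rad A); auto.
  - intros f. apply rho_rad_linear.
  - exact rho_rad_add.
  - exact rho_rad_mul.
  - exact rho_rad_one.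
  (* Block k + i + 1 has dimension above i, so [rad i] is available there. *)
  - intros i. exists (fun k => rad_vec p (S (k + i)) (kron i)). split.
    + apply block_vec_disjoint. intros; lia.
    + intros k. split; [|split].
      * apply rad_vec_kron_energy; [exact Hp0|lia|lra].
      * intros B. apply rad_vec_kron_energy; [exact Hp0|lia].
      * intros f. unfold rad_vec. rewrite rho_rad_block_vec. extensionality n.
        unfold block_vec, vscal. destruct (Nat.eq_dec (blk n) (S (k + i))); [|ring].
        unfold walsh. rewrite <- csum_scal. apply csum_ext. intros l _. unfold kron.
        destruct (Nat.eq_dec l i) as [ -> |]; [ring|].
        rewrite Rmult_0_r. change (RtoC 0) with C0. ring.
Qed.

(** * Bump functions *)

(** A tent of height 1 at j / 2^k with half-width 2^(-k-1), so that tents of one level do not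
    overlap. *)
Definition bump (k j : nat) (t : R) : R := Rmax 0 (1 - 2 * Rabs (2 ^ k * t - INR j)).

Definition bump_sum (k : nat) (t : R) : R := rsum (2 ^ k) (fun j => bump k j t).

Lemma bump_nonneg k j t : 0 <= bump k j t.
Proof. apply Rmax_l. Qed.

(** Two positive values at t put 2^k t at distance below 1/2 from both i and j, so |i - j| < 1. *)
Lemma bump_disjoint k i j t : i <> j -> bump k i t = 0 \/ bump k j t = 0.
Proof.
  intros Hij. destruct (Req_dec (bump k i t) 0) as [|Hi]; [now left|].
  destruct (Req_dec (bump k j t) 0) as [|Hj]; [now right|]. exfalso.
  unfold bump, Rmax in Hi, Hj. repeat destruct (Rle_dec _ _) in Hi; [|lra].
  repeat destruct (Rle_dec _ _) in Hj; [|lra].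
  assert (L : Rabs (INR i - INR j) < 1).
  { replace (INR i - INR j) with ((2 ^ k * t - INR j) - (2 ^ k * t - INR i)) by ring.
    eapply Rle_lt_trans; [apply Rabs_triang|]. rewrite Rabs_Ropp. lra. }
  apply Rabs_def2 in L.
  destruct (Nat.lt_total i j) as [D|[D|D]]; [|contradiction|];
    apply le_INR in D; rewrite S_INR in D; lra.
Qed.

Lemma bump_pt k j i : blk i = k -> bump k j (pt i) = kron (off i) j.
Proof.
  intros E. unfold bump, pt, kron. rewrite E.
  replace (2 ^ k * (INR (off i) / 2 ^ k)) with (INR (off i)) by (field; apply pow_nonzero; lra).
  destruct (Nat.eq_dec j (off i)) as [ -> |Hne].
  - rewrite Rminus_diag, Rabs_R0, Rmax_right; lra.
  - apply Rmax_left. assert (1 <= Rabs (INR (off i) - INR j)); [|lra].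
    destruct (Nat.lt_total j (off i)) as [D|[D|D]]; [|contradiction|];
      apply le_INR in D; rewrite S_INR in D; unfold Rabs; destruct (Rcase_abs _); lra.
Qed.

Lemma bump_sum_pt k i : blk i = k -> bump_sum k (pt i) = 1.
Proof.
  intros E. unfold bump_sum. rewrite (rsum_ext _ _ (kron (off i))).
  - rewrite (rsum_single _ (off i)).
    + unfold kron. destruct (Nat.eq_dec _ _); [reflexivity|lia].
    + rewrite <- E. apply off_lt.
    + intros j _ Hj. unfold kron. destruct (Nat.eq_dec _ _); [lia|reflexivity].
  - intros. now apply bump_pt.
Qed.

Lemma bump_lipschitz k j s t : Rabs (bump k j s - bump k j t) <= 2 * 2 ^ k * Rabs (s - t).
Proof.
  assert (P : 0 < 2 ^ k) by (apply pow_lt; lra).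
  assert (L : Rabs (Rabs (2 ^ k * s - INR j) - Rabs (2 ^ k * t - INR j)) <= 2 ^ k * Rabs (s - t)).
  { eapply Rle_trans; [apply Rabs_triang_inv2|].
    replace (2 ^ k * s - INR j - (2 ^ k * t - INR j)) with (2 ^ k * (s - t)) by ring.
    rewrite Rabs_mult, Rabs_pos_eq by lra. lra. }
  pose proof (Rle_abs (Rabs (2 ^ k * s - INR j) - Rabs (2 ^ k * t - INR j))) as L1.
  pose proof (Rle_abs (- (Rabs (2 ^ k * s - INR j) - Rabs (2 ^ k * t - INR j)))) as L2.
  rewrite Rabs_Ropp in L2. apply Rabs_le. unfold bump, Rmax.
  repeat destruct (Rle_dec _ _); lra.
Qed.

Lemma bump_sum_lipschitz k s t :
  Rabs (bump_sum k s - bump_sum k t) <= 2 ^ k * (2 * 2 ^ k) * Rabs (s - t).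
Proof.
  (* The number of bumps is generalised for the induction, while the Lipschitz constant of each bump
     keeps its real power 2^k. *)
  unfold bump_sum. rewrite <- (INR_pow2 k) at 1. generalize (2 ^ k)%nat as n. intros n.
  induction n as [|n IH].
  - simpl. rewrite Rminus_diag, Rabs_R0. lra.
  - rewrite S_INR. cbn [rsum].
    replace (rsum n (fun j => bump k j s) + bump k n s -
             (rsum n (fun j => bump k j t) + bump k n t))
      with ((rsum n (fun j => bump k j s) - rsum n (fun j => bump k j t)) +
            (bump k n s - bump k n t))
      by ring.
    eapply Rle_trans; [apply Rabs_triang|]. pose proof (bump_lipschitz k n s t). lra.
Qed.

Lemma in_C01_lipschitz g L :
  0 < L -> (forall s t, Rabs (g s - g t) <= L * Rabs (s - t)) -> in_C01 (fun t => RtoC (g t)).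
Proof.
  intros HL Hg t _ e He. exists (e / L). split; [now apply Rdiv_lt_0_compat|].
  intros s _ Hs. replace (Cadd _ _) with (RtoC (g s - g t))
    by (unfold Cadd, Copp, RtoC; simpl; f_equal; ring).
  rewrite Cabs_RtoC. eapply Rle_lt_trans; [apply Hg|].
  replace e with (L * (e / L)) by (field; lra). now apply Rmult_lt_compat_l.
Qed.

Definition bump_fun (k j : nat) : cfun := fun t => RtoC (bump k j t).
Definition bump_sum_fun (k : nat) : cfun := fun t => RtoC (bump_sum k t).

Lemma in_C01_bump_fun k j : in_C01 (bump_fun k j).
Proof.
  apply in_C01_lipschitz with (2 * 2 ^ k); [|apply bump_lipschitz].
  assert (0 < 2 ^ k) by (apply pow_lt; lra). lra.
Qed.

Lemma in_C01_bump_sum_fun k : in_C01 (bump_sum_fun k).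
Proof.
  apply in_C01_lipschitz with (2 ^ k * (2 * 2 ^ k)); [|apply bump_sum_lipschitz].
  assert (0 < 2 ^ k) by (apply pow_lt; lra). nra.
Qed.

(** A diagonal operator acts coordinatewise and at most one bump is nonzero at each coordinate, so
    the energies add exactly. *)
Lemma rho_diag_bump_energy p k y N :
  rsum N (fun n => rpow (Cabs (rho_diag (bump_sum_fun k) y n)) p) =
  rsum (2 ^ k) (fun j => rsum N (fun n => rpow (Cabs (rho_diag (bump_fun k j) y n)) p)).
Proof.
  rewrite rsum_exchange. apply rsum_ext. intros n _.
  unfold rho_diag, bump_sum_fun, bump_fun.
  rewrite (rsum_ext _ _ (fun j => rpow (Cabs (y n)) p * rpow (bump k j (pt (off n))) p)).
  - rewrite rsum_scal, (rsum_disjoint _ (fun u => rpow u p)).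
    + rewrite Cabs_mul, Cabs_RtoC, Rabs_pos_eq
        by (apply rsum_nonneg; intros; apply bump_nonneg).
      rewrite rpow_mult, Rmult_comm; [reflexivity| |apply Cabs_nonneg].
      apply rsum_nonneg; intros; apply bump_nonneg.
    + apply rpow_0.
    + intros. now apply bump_disjoint.
  - intros j _. rewrite Cabs_mul, Cabs_RtoC, Rabs_pos_eq by apply bump_nonneg.
    rewrite rpow_mult by (apply bump_nonneg || apply Cabs_nonneg). ring.
Qed.

(** * Non-equivalence *)

Definition blk_ind (k : nat) : nat -> R := fun i => if Nat.eq_dec (blk i) k then 1 else 0.

(* With [K = 2^N - 1] coordinates, [{i | i < K}] is a union of blocks. *)
Definition test_dim (k m : nat) : nat := (2 ^ S (m + k) - 1)%nat.
(** A sum of 2^k normalised Rademacher functions, one for each dyadic point of block k; varying m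
    moves it through disjoint blocks, along which compact operators tend to 0. *)
Definition test_vec (p : R) (k m : nat) : seqC := rad_vec p (test_dim k m) (blk_ind k).

Lemma test_dim_lt k m j : (j < 2 ^ k)%nat -> (bpos k j < test_dim k m)%nat.
Proof.
  intros Hj. unfold bpos, test_dim.
  assert (2 ^ S k <= 2 ^ S (m + k))%nat by (apply Nat.pow_le_mono_r; lia).
  rewrite Nat.pow_succ_r' in H. pose proof (pow2_pos k). lia.
Qed.

Lemma test_dim_inj k m m' : m <> m' -> test_dim k m <> test_dim k m'.
Proof.
  intros H E. unfold test_dim in E. pose proof (pow2_pos (S (m + k))).
  pose proof (pow2_pos (S (m' + k))).
  assert (E' : (2 ^ S (m + k) = 2 ^ S (m' + k))%nat) by lia.
  apply Nat.pow_inj_r in E'; lia.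
Qed.

(** Among the points of block k, bump j is 1 at j / 2^k and 0 at the others, so it picks out a
    single Rademacher function. *)
Lemma rho_rad_test_bump p k m j : (j < 2 ^ k)%nat ->
  rho_rad (bump_fun k j) (test_vec p k m) = rad_vec p (test_dim k m) (kron (bpos k j)).
Proof.
  intros Hj. apply rho_rad_rad_vec. intros i _. unfold bump_fun. rewrite <- RtoC_mul. f_equal.
  unfold blk_ind. destruct (Nat.eq_dec (blk i) k) as [E|E].
  - rewrite bump_pt by exact E. unfold kron.
    destruct (Nat.eq_dec j (off i)) as [D|D], (Nat.eq_dec i (bpos k j)) as [G|G]; try ring.
    + exfalso. apply G. rewrite D, <- E. symmetry. apply pos_blk_off.
    + exfalso. apply D. rewrite G. now rewrite off_pos.
  - unfold kron. destruct (Nat.eq_dec i (bpos k j)) as [ -> |]; [|ring].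
    rewrite blk_pos in E by exact Hj. contradiction.
Qed.

Lemma rho_rad_test_sum p k m : rho_rad (bump_sum_fun k) (test_vec p k m) = test_vec p k m.
Proof.
  apply rho_rad_rad_vec. intros i _. unfold bump_sum_fun. rewrite <- RtoC_mul. f_equal.
  unfold blk_ind. destruct (Nat.eq_dec (blk i) k) as [E|E]; [|ring].
  rewrite bump_sum_pt by exact E. ring.
Qed.

Lemma blk_ind_sqr_sum k m : rsum (test_dim k m) (fun i => blk_ind k i ^ 2) = 2 ^ k.
Proof.
  unfold test_dim. rewrite rsum_blocks.
  rewrite (rsum_single (S (m + k)) k); [|lia|].
  - rewrite (rsum_ext _ _ (fun _ => 1)).
    + rewrite rsum_const, INR_pow2. ring.
    + intros j Hj. unfold blk_ind. rewrite blk_pos by exact Hj.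
      destruct (Nat.eq_dec k k); [ring|lia].
  - intros l _ Hl. apply rsum_0. intros j Hj. unfold blk_ind. rewrite blk_pos by exact Hj.
    destruct (Nat.eq_dec l k); [lia|ring].
Qed.

(** The coefficients have l^2 norm 2^(k/2), so Khintchine's inequality and its dual place the energy
    at 2^(kp/2), written as the k-th power of (sqrt 2)^p, uniformly in m. *)
Lemma test_vec_energy p : 1 < p -> exists A, 0 < A /\ forall k m,
  lp_le p (test_vec p k m) (A * rpow (sqrt 2) p ^ k) /\
  forall B, lp_le p (test_vec p k m) B -> rpow (sqrt 2) p ^ k <= A * B.
Proof.
  intros Hp. assert (Hp0 : 0 < p) by lra.
  destruct (khintchine p Hp0) as [A1 [HA1 H1]].
  destruct (khintchine_dual p Hp) as [A2 [HA2 H2]].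
  exists (A1 + A2). split; [lra|]. intros k m.
  set (K := test_dim k m).
  assert (P : 0 < 2 ^ K) by (apply pow_lt; lra).
  pose proof (sqrt_pos 2) as S0.
  assert (Sk : 0 <= sqrt 2 ^ k) by now apply pow_le.
  assert (E : (sqrt 2 ^ k) ^ 2 = rsum K (fun i => blk_ind k i ^ 2)).
  { unfold K. rewrite blk_ind_sqr_sum. simpl. rewrite Rmult_1_r, <- Rpow_mult_distr.
    now rewrite sqrt_sqrt by lra. }
  rewrite <- rpow_pow by exact S0. pose proof (rpow_nonneg (sqrt 2 ^ k) p) as W.
  split.
  - apply rad_vec_energy; [exact Hp0|]. fold K.
    eapply Rle_trans; [apply (H1 K (blk_ind k) (sqrt 2 ^ k) Sk); lra|].
    assert (0 <= 2 ^ K * rpow (sqrt 2 ^ k) p) by (apply Rmult_le_pos; lra). nra.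
  - intros B HB. pose proof (lp_le_nonneg _ _ _ HB) as B0.
    apply rad_vec_energy in HB; [|exact Hp0]. fold K in HB.
    assert (L : 2 ^ K * rpow (sqrt 2 ^ k) p <= 2 ^ K * (A2 * B)).
    { eapply Rle_trans; [apply (H2 K (lin K (blk_ind k)) (sqrt 2 ^ k) Sk)|].
      - rewrite E. apply rsum_ext. intros i Hi. now rewrite rcoef_lin.
      - replace (2 ^ K * (A2 * B)) with (A2 * (B * 2 ^ K)) by ring.
        apply Rmult_le_compat_l; [lra|exact HB]. }
    apply Rmult_le_reg_l in L; [|exact P]. nra.
Qed.

Lemma test_vec_disjoint p k : disjoint_seq (test_vec p k).
Proof.
  apply (block_vec_disjoint (test_dim k)). intros. now apply test_dim_inj.
Qed.

(** Two cases are treated at once: [J] is the identity for [rho_rad] alone, and interleaving with 0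
    for its sum with a third extension. *)
Record energy_embedding (p : R) (J : seqC -> seqC) : Prop := {
  embedding_energy : forall x B, lp_le p (J x) B <-> lp_le p x B;
  embedding_disjoint : forall v, disjoint_seq v -> disjoint_seq (fun k => J (v k)) }.

(* Along [J (test_vec p k m)], with [m] large enough to make the compact errors negligible, the
   conjugating operator compares the energy of a sum of [2^k] Rademacher functions, which is
   of order [2^(kp/2)], with the sum [2^k] of their energies. *)
Lemma equiv_diag_estimates p Psi J :
  1 < p -> energy_embedding p J ->
  (forall f x, in_C01 f -> in_lp p x -> Psi f (J x) = J (rho_rad f x)) ->
  equiv_ext p rho_diag Psi ->
  exists A, forall k, rpow (sqrt 2) p ^ k <= A * 2 ^ k /\ 2 ^ k <= A * rpow (sqrt 2) p ^ k.
Proof.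
  intros Hp [JE JD] HJ [S [Si [[HS [HSi [HSSi HSiS]]] Hcpt]]]. assert (Hp0 : 0 < p) by lra.
  destruct (test_vec_energy p Hp) as [A [HA HT]].
  destruct (bounded_op_has_energy p S Hp0 HS) as [cS [HcS ES]].
  destruct (bounded_op_has_energy p Si Hp0 HSi) as [cI [HcI EI]].
  set (q := rpow 2 p). assert (Hq : 1 <= q) by now apply rpow_2_ge1.
  set (b := cS * cI * q).
  assert (Hb : 0 <= b) by (repeat apply Rmult_le_pos; lra).
  (* The two summands are the constants of the two inequalities, added to have one constant for
     both. *)
  exists (A * (q * (2 * b + 1)) + 2 * q * b * (A + 1)). intros k.
  set (w := rpow (sqrt 2) p ^ k).
  assert (Hw1 : 1 <= w).
  { apply pow_R1_Rle. rewrite <- (rpow_1 p). apply rpow_le; [exact Hp0|lra|].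
    rewrite <- sqrt_1. apply sqrt_le_1_alt. lra. }
  assert (Hk : 1 <= 2 ^ k) by (apply pow_R1_Rle; lra).
  set (v := fun m => J (test_vec p k m)).
  set (err := fun f => opsub (opcomp S (opcomp (rho_diag f) Si)) (Psi f)).
  (* This makes q d = 1/2, so the error takes only half of the unit energy in the second
     estimate. *)
  set (d := / (2 * q)).
  assert (Hd : 0 < d) by (apply Rinv_0_lt_compat; lra).
  assert (Hd1 : d <= 1).
  { unfold d. rewrite <- Rinv_1. apply Rinv_le_contravar; lra. }
  assert (Hdq : q * d = / 2) by (unfold d; field; lra).
  assert (Vd : disjoint_seq v) by apply JD, test_vec_disjoint.
  assert (Ve : forall m, lp_le p (v m) (A * w)) by (intros; apply JE, HT).
  assert (small : forall f, in_C01 f ->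
    exists m0, forall m, (m0 <= m)%nat -> lp_le p (err f (v m)) d).
  { intros f Hf. exact (compact_disjoint_null p _ v _ Hp (Hcpt f Hf) Vd Ve d Hd). }
  (* One index m has to serve all 2^k bumps and their sum. *)
  destruct (eventually_forall_lt (fun j m => lp_le p (err (bump_fun k j) (v m)) d) (2 ^ k))
    as [m1 Hm1]; [intros; apply small, in_C01_bump_fun|].
  destruct (small _ (in_C01_bump_sum_fun k)) as [m2 Hm2].
  set (m := Nat.max m1 m2).
  assert (Ej : forall j, (j < 2 ^ k)%nat -> lp_le p (err (bump_fun k j) (v m)) d)
    by (intros; apply Hm1; lia).
  assert (EF : lp_le p (err (bump_sum_fun k) (v m)) d) by (apply Hm2; lia).
  set (y := Si (v m)).
  assert (Vin : in_lp p (v m)) by (eapply lp_le_in_lp, Ve).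
  assert (Yin : in_lp p y) by apply HSi, Vin.
  assert (Din : forall f, in_C01 f -> in_lp p (rho_diag f y)).
  { intros f Hf. destruct (trivial_ext_diag p Hp) as [[Hbd _] _]. now apply Hbd. }
  (* [toD] and [fromD] carry energy bounds between [Psi f (v m)] and [rho_diag f y], through the
     identity [S (rho_diag f y) = Psi f (v m) + err f (v m)]. *)
  assert (toD : forall f B, in_C01 f -> lp_le p (Psi f (v m)) B -> lp_le p (err f (v m)) d ->
    lp_le p (rho_diag f y) (cI * (q * (B + d)))).
  { intros f B Hf HB He.
    replace (rho_diag f y) with (Si (vadd (Psi f (v m)) (err f (v m)))).
    - apply EI, lp_le_vadd; assumption.
    - etransitivity; [|exact (HSiS (rho_diag f y) (Din f Hf))]. unfold opcomp at 1. f_equal.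
      extensionality n. unfold err, opsub, opcomp, vadd, vsub, y. ring. }
  assert (fromD : forall f B, in_C01 f -> lp_le p (rho_diag f y) B -> lp_le p (err f (v m)) d ->
    lp_le p (Psi f (v m)) (q * (cS * B + d))).
  { intros f B Hf HB He.
    replace (Psi f (v m)) with (vsub (S (rho_diag f y)) (err f (v m))).
    - apply lp_le_vsub; [exact Hp0|now apply ES|exact He].
    - extensionality n. unfold err, opsub, opcomp, vadd, vsub, y. ring. }
  assert (Tin : in_lp p (test_vec p k m)) by (eapply lp_le_in_lp, HT).
  assert (PF : Psi (bump_sum_fun k) (v m) = v m).
  { unfold v. rewrite HJ by auto using in_C01_bump_sum_fun. now rewrite rho_rad_test_sum. }
  assert (Pj : forall j B, (j < 2 ^ k)%nat -> lp_le p (Psi (bump_fun k j) (v m)) B <-> 1 <= B).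
  { intros j B Hj. unfold v. rewrite HJ by auto using in_C01_bump_fun.
    rewrite rho_rad_test_bump by exact Hj. rewrite JE.
    apply rad_vec_kron_energy; [exact Hp0|now apply test_dim_lt]. }
  split.
  (* Each bump applied to [y] has bounded energy, and disjointness makes the energy of their sum
     O(2^k); carried back to [v m], this bounds [w] from above. *)
  - assert (LF : lp_le p (rho_diag (bump_sum_fun k) y) (2 ^ k * (cI * (q * (1 + d))))).
    { intros N. rewrite rho_diag_bump_energy.
      rewrite <- (INR_pow2 k), <- rsum_const. apply rsum_le. intros j Hj.
      apply toD; [apply in_C01_bump_fun|now apply Pj|now apply Ej]. }
    apply fromD in LF; [|apply in_C01_bump_sum_fun|exact EF]. rewrite PF in LF.
    apply JE, HT in LF. fold w in LF.
    apply Rle_trans with (1 := LF).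
    apply Rle_trans with (A * (q * (2 * b + 1)) * 2 ^ k).
    + rewrite Rmult_assoc. apply Rmult_le_compat_l; [lra|].
      rewrite Rmult_assoc. apply Rmult_le_compat_l; [lra|].
      replace (cS * (2 ^ k * (cI * (q * (1 + d))))) with (2 ^ k * b * (1 + d))
        by (unfold b; ring).
      assert (0 <= 2 ^ k * b) by (apply Rmult_le_pos; lra). nra.
    + apply Rmult_le_compat_r; [lra|].
      assert (0 <= 2 * q * b * (A + 1)) by (repeat apply Rmult_le_pos; lra). lra.
  - assert (LF : lp_le p (rho_diag (bump_sum_fun k) y) (cI * (q * (A * w + d)))).
    { apply toD; [apply in_C01_bump_sum_fun| |exact EF]. rewrite PF. apply Ve. }
    set (B := cI * (q * (A * w + d))) in *.
    (* The bump sum applied to [y] has energy at most B = O(w), so some bump gets at most the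
       average share B / 2^k. *)
    assert (Hj : exists j, (j < 2 ^ k)%nat /\ lp_le p (rho_diag (bump_fun k j) y) (B / 2 ^ k)).
    { apply NNPP. intros Hno.
      (* Otherwise one N would put all 2^k partial sums above the average at once, and their total
         above B. *)
      destruct (eventually_forall_lt (fun j N =>
        B / 2 ^ k < rsum N (fun n => rpow (Cabs (rho_diag (bump_fun k j) y n)) p)) (2 ^ k))
        as [N HN].
      - intros j Hj. apply NNPP. intros Hn. apply Hno. exists j. split; [exact Hj|].
        intros N. apply Rnot_lt_le. intros L. apply Hn. exists N. intros N' HN'.
        eapply Rlt_le_trans; [exact L|]. apply rsum_mono; [exact HN'|].
        intros; apply rpow_nonneg.
      - specialize (LF N). rewrite rho_diag_bump_energy in LF.
        specialize (HN N (le_n N)).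
        pose proof (pow2_pos k) as Pk.
        assert (L : rsum (2 ^ k) (fun _ => B / 2 ^ k) <
          rsum (2 ^ k) (fun j => rsum N (fun n => rpow (Cabs (rho_diag (bump_fun k j) y n)) p))).
        { destruct (2 ^ k)%nat as [|n]; [lia|]. cbn [rsum].
          apply Rplus_le_lt_compat; [|apply HN; lia].
          apply rsum_le. intros j Hj. apply Rlt_le, HN. lia. }
        rewrite rsum_const, INR_pow2 in L.
        replace (2 ^ k * (B / 2 ^ k)) with B in L by (field; lra). lra. }
    destruct Hj as [j [Hj LB]].
    (* Carried back, this bump yields a single normalised Rademacher function of energy 1, whence 1
       <= O(w / 2^k) + 1/2. *)
    apply fromD in LB; [|apply in_C01_bump_fun|now apply Ej].
    apply Pj in LB; [|exact Hj].
    rewrite Rmult_plus_distr_l, Hdq in LB.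
    assert (L : 2 ^ k <= 2 * q * (cS * B)).
    { apply Rmult_le_compat_l with (r := 2 * 2 ^ k) in LB; [|lra].
      replace (2 * 2 ^ k * (q * (cS * (B / 2 ^ k)) + / 2)) with (2 * q * (cS * B) + 2 ^ k) in LB
        by (field; lra). lra. }
    apply Rle_trans with (1 := L).
    apply Rle_trans with (2 * q * b * (A + 1) * w).
    + replace (2 * q * (cS * B)) with (2 * q * b * (A * w + d)) by (unfold B, b; ring).
      rewrite (Rmult_assoc (2 * q * b)). apply Rmult_le_compat_l; [repeat apply Rmult_le_pos; lra|].
      lra.
    + apply Rmult_le_compat_r; [lra|].
      assert (0 <= A * (q * (2 * b + 1))) by (repeat apply Rmult_le_pos; lra). lra.
Qed.

(** The powers of (sqrt 2)^p and of 2 are comparable in both directions only for p = 2: p < 2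
    contradicts the second estimate, p > 2 the first. *)
Lemma not_equiv_diag p Psi J :
  1 < p -> p <> 2 -> energy_embedding p J ->
  (forall f x, in_C01 f -> in_lp p x -> Psi f (J x) = J (rho_rad f x)) ->
  ~ equiv_ext p rho_diag Psi.
Proof.
  intros Hp Hp2 HE HJ Heq.
  destruct (equiv_diag_estimates p Psi J Hp HE HJ Heq) as [A HA].
  assert (S1 : 1 < sqrt 2) by (rewrite <- sqrt_1; apply sqrt_lt_1_alt; lra).
  assert (E2 : rpow (sqrt 2) 2 = 2).
  { rewrite rpow_Rpower by lra. replace 2 with (INR 2) at 2 by reflexivity.
    rewrite Rpower_pow by lra. simpl. rewrite Rmult_1_r. apply sqrt_sqrt. lra. }
  destruct (Rlt_or_le p 2) as [L|L].
  - apply (geometric_gap (rpow (sqrt 2) p) 2 A); [|intros; apply HA].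
    split; [apply rpow_pos; lra|]. rewrite <- E2 at 2. rewrite !rpow_Rpower by lra.
    now apply Rpower_lt.
  - apply (geometric_gap 2 (rpow (sqrt 2) p) A); [|intros; apply HA].
    split; [lra|]. rewrite <- E2 at 1. rewrite !rpow_Rpower by lra.
    apply Rpower_lt; lra.
Qed.

(** * Interleaving with zero and the final theorem *)

Lemma evens_interleave x y : evens (interleave x y) = x.
Proof.
  extensionality n. unfold evens, interleave. now rewrite Nat.even_even, Nat.div2_double.
Qed.

Lemma odds_interleave x y : odds (interleave x y) = y.
Proof.
  extensionality n. unfold odds, interleave. rewrite Nat.div2_succ_double.
  rewrite <- Nat.add_1_r, Nat.even_odd. reflexivity.
Qed.

Lemma interleave_embedding p : energy_embedding p (fun x => interleave x vzero).
Proof.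
  split.
  - intros x B.
    assert (E : forall N, rsum (2 * N) (fun n => rpow (Cabs (interleave x vzero n)) p) =
                          rsum N (fun n => rpow (Cabs (x n)) p)).
    { intros N. rewrite rsum_double. apply rsum_ext. intros j _.
      change (interleave x vzero (2 * j)%nat) with (evens (interleave x vzero) j).
      change (interleave x vzero (S (2 * j))) with (odds (interleave x vzero) j).
      rewrite evens_interleave, odds_interleave. unfold vzero. rewrite Cabs_C0, rpow_0. ring. }
    split; intros H N.
    + rewrite <- E. apply H.
    + eapply Rle_trans; [|apply (H N)]. rewrite <- E.
      apply rsum_mono; [lia|]. intros; apply rpow_nonneg.
  - intros v Hv j k n Hjk. unfold interleave, vzero. destruct (Nat.even n); [now apply Hv|now left].
Qed.

Theorem theorem5p22 (p : R) (hp1 : 1 < p) (hp2 : p <> 2) :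
  exists Phi1 Phi2 : cfun -> op,
    trivial_ext p Phi1 /\ trivial_ext p Phi2 /\
    ~ equiv_ext p Phi1 Phi2 /\
    forall Phi3 : cfun -> op, iso_ext p Phi3 ->
      ~ equiv_ext p Phi1 (sum_ext Phi2 Phi3).
Proof.
  exists rho_diag, rho_rad.
  split; [now apply trivial_ext_diag|]. split; [now apply trivial_ext_rad|]. split.
  - apply (not_equiv_diag p rho_rad (fun x => x)); try assumption; [|reflexivity].
    split; [reflexivity|]. intros v Hv. exact Hv.
  - intros Phi3 [Hb _].
    apply (not_equiv_diag p _ (fun x => interleave x vzero)); try assumption;
      [apply interleave_embedding|].
    (* [Phi3 f] sends the zero half to zero by linearity, so on embedded vectors the sum acts as
       [rho_rad f] alone. *)
    intros f x Hf _. unfold sum_ext, dsum. rewrite evens_interleave, odds_interleave.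
    destruct (Hb f Hf) as [_ [Hl _]]. now rewrite (linear_vzero p (Phi3 f) Hl).
Qed.
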